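(* Let $\omega$ be a weight sequence and let $T_1$ and $T_2$ be two pure $\omega$-hypercontractions on Hilbert spaces $\mathcal H_1$ and $\mathcal H_2$, respectively. For $i=1,2$ let $\theta_{T_i}$ be the characteristic function of $T_i$ corresponding to a characteristic triple $(\mathcal E_i,B_i,D_i)$ of $T_i$. Then $T_1$ and $T_2$ are unitarily equivalent if and only if $\theta_{T_1}$ and $\theta_{T_2}$ coincide.
   Context: All Hilbert spaces are complex; $\mathbb D$ is the open unit disc, $\mathbb Z_+=\{0,1,2,\dots\}$. A weight sequence is a decreasing (non-increasing) sequence $\omega=\{\omega_k\}_{k\ge0}$ of positive numbers with $\omega_0=1$, $\liminf_{k\to\infty}\omega_k^{1/k}=1$, such that $k_\omega(z)=\sum_{k\ge0}\frac1{\omega_k}z^k$ has no zeros on $\mathbb D$ and, with $k_{\omega,r}(z)=k_\omega(rz)$: (P1) $k_\omega/k_{\omega,r}$ has non-negative Taylor coefficients for every $0<r<1$; (P2) the Taylor coefficients of $k_{\omega,r}/k_\omega$, $0<r<1$, are uniformly bounded. Write $\frac1{k_\omega(z)}=\sum_{n\ge0}c_nz^n$. A contraction $T\in\mathcal B(\mathcal H)$ is an $\omega$-hypercontraction if $D_{\omega,T}(r):=\sum_{n\ge0}c_nr^nT^nT^{*n}\ge0$ for all $r\in(0,1)$; it is pure if $T^{*n}\to0$ strongly. For an $\omega$-hypercontraction the strong limit $D_{\omega,T}(1)=\lim_{r\to1}D_{\omega,T}(r)\ge0$ exists; put $D_{\omega,T}=D_{\omega,T}(1)^{1/2}$ and $\mathcal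 D_{\omega,T}=\overline{\operatorname{ran}}\,D_{\omega,T}$. Let $\rho_0=1$, $\rho_n=\frac1{\omega_n}-\frac1{\omega_{n-1}}$ ($n\ge1$). For a pure $\omega$-hypercontraction $T$ on $\mathcal H$, $C_{\omega,T}:\mathcal H\to\ell^2(\mathbb Z_+,\mathcal D_{\omega,T})$ is the contraction $C_{\omega,T}h=\{\sqrt{\rho_n}D_{\omega,T}T^{*n}h\}_{n\ge0}$. A characteristic triple of $T$ is a triple $(\mathcal E,B,D)$ consisting of a Hilbert space $\mathcal E$ and bounded operators $B\in\mathcal B(\mathcal E,\mathcal H)$, $D=\{D_n\}_{n\ge0}\in\mathcal B(\mathcal E,\ell^2(\mathbb Z_+,\mathcal D_{\omega,T}))$ (with components $D_n\in\mathcal B(\mathcal E,\mathcal D_{\omega,T})$) such that $\begin{bmatrix}T^*&B\\C_{\omega,T}&D\end{bmatrix}:\mathcal H\oplus\mathcal E\to\mathcal H\oplus\ell^2(\mathbb Z_+,\mathcal D_{\omega,T})$ is unitary. The characteristic function of $T$ corresponding to the triple is the function $\theta_T:\mathbb D\to\mathcal B(\mathcal E,\mathcal D_{\omega,T})$, $$\theta_T(z)=\sum_{n\ge0}\sqrt{\rho_n}\,D_nz^n+zD_{\omega,T}\sum_{n\ge0}\frac1{\omega_n}z^nT^{*n}B .$$ $\theta_{T_1}$ and $\theta_{T_2}$ coincide if there exist unitaries $\tau:\mathcal E_2\to\mathcal E_1$ and $\tau_*:\mathcal D_{\omega,T_1}\to\mathcal D_{\omega,T_2}$ such that $\theta_{T_2}(z)=\tau_*\theta_{T_1}(z)\tau$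 for all $z\in\mathbb D$. *)

(* Defs.v *)
From HB Require Import structures.
From mathcomp Require Import all_boot all_order all_algebra.
From mathcomp Require Import sesquilinear.
From mathcomp Require Import all_classical all_reals all_analysis.
From mathcomp Require Import complex.

Set Implicit Arguments.
Unset Strict Implicit.
Unset Printing Implicit Defensive.

Import Order.TTheory GRing.Theory Num.Theory.
Import numFieldNormedType.Exports.

Local Open Scope classical_set_scope.
Local Open Scope ring_scope.
Local Open Scope complex_scope.

(* The inner product is linear in its first argument. *)
HB.mixin Record CompleteNormedModule_isHilbert (R : realType) H
    of CompleteNormedModule R[i] H := {
  inner : {dot H for @Num.conj R[i]};
  inner_normE : forall x : H, inner x x = `|x| ^+ 2
}.

#[short(type="hilbertType")]
HB.structure Definition Hilbert (R : realType) :=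
  {H of CompleteNormedModule R[i] H & CompleteNormedModule_isHilbert R H}.

Section Operators.
Context {R : realType}.
Implicit Types H K : hilbertType R.

Definition bounded_operator H K (f : H -> K) : Prop :=
  linear f /\ exists M : R[i], forall x, `|f x| <= M * `|x|.

(* The operator S with <T x, y> = <x, S y>; such an S is unique, and it exists
   when T is a bounded operator. *)
Definition adjoint H K (T : H -> K) : K -> H :=
  xget (fun=> 0) [set S | forall x y, inner (T x) y = inner x (S y)].

(* [0 <= z] in [R[i]] means that z is real and non-negative. *)
Definition positive_operator H (A : H -> H) : Prop :=
  forall x, 0 <= inner (A x) x.

(* The positive square root of A: it is unique, and it exists when A is a
   bounded positive operator. *)
Definition positive_sqrt H (A : H -> H) : H -> H :=
  xget (fun=> 0)
    [set S | [/\ bounded_operator S, positive_operator S & S \o S = A]].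

Definition contraction H (T : H -> H) : Prop :=
  bounded_operator T /\ forall x, `|T x| <= `|x|.

Definition pure H (T : H -> H) : Prop :=
  forall x, iter n (adjoint T) x @[n --> \oo] --> (0 : H).

(* u restricts to a unitary operator from the linear subspace A of V, with
   inner product ipA, onto the linear subspace B of W, with inner product ipB.
   The values of u outside A are irrelevant. *)
Definition unitary_between (V W : lmodType R[i])
    (A : set V) (ipA : V -> V -> R[i]) (B : set W) (ipB : W -> W -> R[i])
    (u : V -> W) : Prop :=
  [/\ forall (a : R[i]) x y, A x -> A y -> u (a *: x + y) = a *: u x + u y,
      forall x y, A x -> A y -> ipB (u x) (u y) = ipA x y
    & u @` A = B].

Definition unitary H K (u : H -> K) : Prop :=
  unitary_between setT inner setT inner u.

Definition unitarily_equivalent H K (T : H -> H) (S : K -> K) : Prop :=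
  exists2 u : H -> K, unitary u & forall x, u (T x) = S (u x).

(* l^2(Z_+, A) for a closed subspace A of H *)
Definition l2 H (A : set H) : set (nat -> H) :=
  [set x | (forall n, A (x n)) /\
           cvgn (series (fun n => `|x n| ^+ 2 : R[i]^o))].

(* The series converges for x and y in l2 A, by Cauchy-Schwarz. *)
Definition l2_inner H (x y : nat -> H) : R[i] :=
  limn (series (fun n => inner (x n) (y n) : R[i]^o)).

Definition l2_norm H (x : nat -> H) : R[i] := sqrtC (l2_inner x x).

Definition sum_inner (V W : Type) (ipV : V -> V -> R[i]) (ipW : W -> W -> R[i])
    (p q : V * W) : R[i] := ipV p.1 q.1 + ipW p.2 q.2.

End Operators.

Section Weights.
Context {R : realType}.
Implicit Types w : nat -> R.

(* derive1n over R[i] is the complex derivative; it depends only on the germ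
   of f, so the values of kfun outside the unit disc are irrelevant. *)
Definition taylor_coef (f : R[i] -> R[i]^o) (n : nat) : R[i] :=
  derive1n n f 0 / n`!%:R.

Definition kfun w (z : R[i]) : R[i]^o :=
  limn (series (fun k => (w k)^-1%:C * z ^+ k : R[i]^o)).

Definition kfun_dil w (r : R) (z : R[i]) : R[i]^o := kfun w (r%:C * z).

Definition weight_sequence w : Prop :=
  [/\ [/\ forall k, 0 < w k,
          nonincreasing_seq w,
          w 0%N = 1
        & limn_einf (fun k => (w k `^ k%:R^-1)%:E) = 1%E],
      forall z : R[i], `|z| < 1 -> kfun w z != 0,
      forall r : R, 0 < r < 1 ->
        forall n, 0 <= taylor_coef (fun z => kfun w z / kfun_dil w r z) n
    & exists M : R[i], forall r : R, 0 < r < 1 ->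
        forall n, `|taylor_coef (fun z => kfun_dil w r z / kfun w z) n| <= M].

(* 1 / k_w (z) = \sum_n ccoef w n * z ^+ n on the unit disc *)
Definition ccoef w : nat -> R[i] := taylor_coef (fun z => (kfun w z)^-1).

Definition rho w (n : nat) : R :=
  if n is m.+1 then (w n)^-1 - (w m)^-1 else 1.

End Weights.

Section Hypercontractions.
Context {R : realType}.
Variables (w : nat -> R) (H : hilbertType R) (T : H -> H).

(* The operator series here and in char_fun are summed pointwise; they also
   converge in operator norm, to the same sum. *)
Definition defect_at (r : R) (x : H) : H :=
  limn (series (fun n =>
    (ccoef w n * r%:C ^+ n) *: iter n T (iter n (adjoint T) x))).

Definition hypercontraction : Prop :=
  contraction T /\ forall r : R, 0 < r < 1 -> positive_operator (defect_at r).

Definition defect_one (x : H) : H := lim (defect_at r x @[r --> 1^'-]).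

Definition defect : H -> H := positive_sqrt defect_one.

Definition defect_space : set H := closure (range defect).

Definition Cop (x : H) : nat -> H :=
  fun n => (Num.sqrt (rho w n))%:C *: defect (iter n (adjoint T) x).

Variables (E : hilbertType R) (B : E -> H) (D : E -> nat -> H).

(* The block operator [T^* B; C D] on H (+) E, with values in H (+) H^Z_+. *)
Definition colligation (p : H * E) : H * (nat -> H) :=
  (adjoint T p.1 + B p.2, fun n => Cop p.1 n + D p.2 n).

Definition characteristic_triple : Prop :=
  [/\ bounded_operator B,
      [/\ linear D, forall e, l2 defect_space (D e)
        & exists M : R[i], forall e, l2_norm (D e) <= M * `|e|]
    & unitary_between setT (sum_inner inner inner)
        (setT `*` l2 defect_space) (sum_inner inner (@l2_inner R H))
        colligation].

Definition char_fun (z : R[i]) (e : E) : H :=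
  limn (series (fun n => ((Num.sqrt (rho w n))%:C * z ^+ n) *: D e n)) +
  z *: defect (limn (series (fun n =>
    ((w n)^-1%:C * z ^+ n) *: iter n (adjoint T) (B e)))).

End Hypercontractions.

(* theta1 and theta2 are functions on the unit disc with values in B(E1, A1)
   and B(E2, A2), for closed subspaces A1 of H1 and A2 of H2. *)
Definition coincide (R : realType) (H1 H2 E1 E2 : hilbertType R)
    (A1 : set H1) (theta1 : R[i] -> E1 -> H1)
    (A2 : set H2) (theta2 : R[i] -> E2 -> H2) : Prop :=
  exists (tau : E2 -> E1) (taus : H1 -> H2),
    [/\ unitary tau, unitary_between A1 inner A2 inner taus
      & forall z, `|z| < 1 ->
          forall e, theta2 z e = taus (theta1 z (tau e))].

(* Main.v *)
(* The colligation being unitary, the Taylor coefficients [theta_n] of the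
   characteristic function and the operators [v_n = w_n^-1 D T^*^n] satisfy
   [theta_n theta_m^* = rho_n delta_nm + v_(n-1) v_(m-1)^* - v_n v_m^*].
   Hence [theta] determines all the [v_n v_m^*].  By purity the [v_n] determine
   the inner product of [H], so mapping [v_m^* y] to the corresponding vector of
   the second model extends to a unitary intertwining [T_1^*] and [T_2^*].

   Conversely, a unitary [u] intertwining [T_1] and [T_2] intertwines the
   defect operators, by uniqueness of positive square roots.  Then [u (+) u]
   carries the image of [H_1] under the first colligation to that of [H_2]
   under the second one, hence also the images of the orthogonal complements
   [E_1] and [E_2], which yields [tau]. *)

From mathcomp Require Import all_boot all_order all_algebra sesquilinear.
From mathcomp Require Import all_classical all_reals all_analysis complex.
From mathcomp Require Import ring lra.
Require Import Defs.

Set Implicit Arguments.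
Unset Strict Implicit.
Unset Printing Implicit Defensive.

Import Order.TTheory GRing.Theory Num.Theory.
Import numFieldNormedType.Exports.

Local Open Scope classical_set_scope.
Local Open Scope ring_scope.
Local Open Scope complex_scope.

(** * Operators on Hilbert spaces *)

(** The recursion for [v_n v_m^*] needs no initial data: at [n = 0] or [m = 0] the shifted term
    vanishes, so descending the diagonal recovers every product from the characteristic function.

    The obstacle is that [defect_at], [defect_one] and [defect] are two limits and a choice, each
    with a default value. From coincidence to equivalence the argument rests on boundedness and
    symmetry of [defect], which the default [0] shares. In the other direction the intertwining must
    survive every default. A divergent defect series forces the default vector [point] to be [0] by
    positivity. A divergent limit at [1] forces the same by homogeneity of a squared linear
    operator. A missing square root makes [defect] vanish, and then purity collapses the whole space
    to [0]. What remains is the case of two genuine roots, where uniqueness of the positive root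
    applies.

    A second constraint is that [taus] is linear and isometric only on the defect space, hence the
    membership checks before it is moved through sums and limits. *)

Section Hilbert.
Context {R : realType}.
Implicit Types H K : hilbertType R.

Lemma innerDl H (x y z : H) : inner (x + y) z = inner x z + inner y z.
Proof. exact: linearDl. Qed.

Lemma innerDr H (x y z : H) : inner z (x + y) = inner z x + inner z y.
Proof. exact: linearDr. Qed.

Lemma innerNl H (x z : H) : inner (- x) z = - inner x z.
Proof. exact: linearNl. Qed.

Lemma innerNr H (x z : H) : inner z (- x) = - inner z x.
Proof. exact: linearNr. Qed.

Lemma innerBl H (x y z : H) : inner (x - y) z = inner x z - inner y z.
Proof. exact: linearBl. Qed.

Lemma innerBr H (x y z : H) : inner z (x - y) = inner z x - inner z y.
Proof. exact: linearBr. Qed.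

Lemma inner0l H (z : H) : inner 0 z = 0.
Proof. exact: linear0l. Qed.

Lemma inner0r H (z : H) : inner z 0 = 0.
Proof. exact: linear0r. Qed.

Lemma innerZl H a (x z : H) : inner (a *: x) z = a * inner x z.
Proof. exact: linearZl_LR. Qed.

Lemma innerZr H a (x z : H) : inner z (a *: x) = Num.conj a * inner z x.
Proof. exact: linearZr_LR. Qed.

Lemma innerC H (x y : H) : inner x y = Num.conj (inner y x).
Proof. by rewrite hermC /= expr0 mul1r. Qed.

Lemma inner_ge0 H (x : H) : 0 <= inner x x.
Proof. by rewrite inner_normE exprn_ge0. Qed.

Lemma inner_eq0 H (x : H) : inner x x = 0 -> x = 0.
Proof. by rewrite inner_normE => /eqP; rewrite expf_eq0 /= normr_eq0 => /eqP. Qed.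

Lemma inner_ext H (x y : H) : (forall z, inner z x = inner z y) -> x = y.
Proof.
move=> h; apply/eqP; rewrite -subr_eq0; apply/eqP/inner_eq0.
by rewrite innerBr h subrr.
Qed.

(** Semidefiniteness is enough, so that the inequality serves both [inner] and the possibly
    degenerate form [<A x, y>] of a positive operator. *)
Lemma psd_form_CauchySchwarz (V : lmodType R[i]) (f : V -> V -> R[i]) :
  (forall a x y z, f (a *: x + y) z = a * f x z + f y z) ->
  (forall x y, f y x = Num.conj (f x y)) -> (forall x, 0 <= f x x) ->
  forall x y, `|f x y| ^+ 2 <= f x x * f y y.
Proof.
move=> fl fC f0.
have fr a u v z : f z (a *: u + v) = Num.conj a * f z u + f z v.
  by rewrite fC fl rmorphD rmorphM /= -!fC.
have fD a b x y : f (a *: x + b *: y) (a *: x + b *: y) =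
    a * (Num.conj a * f x x + Num.conj b * f x y) +
    b * (Num.conj a * f y x + Num.conj b * f y y).
  have f0l z : f 0 z = 0.
    by have /eqP := fl 1 0 0 z; rewrite scaler0 addr0 mul1r addrC -subr_eq subrr => /eqP.
  have f0r z : f z 0 = 0 by rewrite fC f0l conjC0.
  by rewrite -[b *: y]addr0 !fl f0l !fr !f0r !addr0.
have CS x y : f y y != 0 -> `|f x y| ^+ 2 <= f x x * f y y.
  move=> yn0; have := f0 (f y y *: x + (- f x y) *: y); rewrite fD.
  rewrite rmorphN /= -(fC y y) -(fC x y).
  have -> : f y y * (f y y * f x x + - f y x * f x y) +
     - f x y * (f y y * f y x + - f y x * f y y) =
     f y y * (f x x * f y y - f x y * f y x) by ring.
  rewrite pmulr_rge0 ?lt_def ?yn0 ?f0 // subr_ge0 (fC x y) => h.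
  by rewrite -normCK in h.
move=> x y; have [y0|/CS//] := eqVneq (f y y) 0.
have [x0|/(CS y) h] := eqVneq (f x x) 0; last first.
  by rewrite -norm_conjC -fC mulrC.
(* With both diagonal values zero, the form at [x - f x y *: y] equals [- 2 |f x y|^2]. *)
have := f0 (1 *: x + (- f x y) *: y); rewrite fD x0 y0 !mulr0 add0r addr0.
rewrite rmorph1 rmorphN /= !mul1r (fC x y) !mulNr [Num.conj _ * _]mulrC -normCK.
rewrite -opprD oppr_ge0 => h; apply: le_trans h.
by rewrite lerDl exprn_ge0.
Qed.

Lemma inner_CauchySchwarz H (x y : H) : `|inner x y| <= `|x| * `|y|.
Proof.
rewrite -(@ler_pXn2r _ 2) ?nnegrE ?mulr_ge0 // exprMn -!inner_normE.
apply: psd_form_CauchySchwarz => [a u v z|u v|u]; last exact: inner_ge0.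
- by rewrite innerDl innerZl.
- exact: innerC.
Qed.

Lemma real_complexD (x y : R) : (x + y)%:C = x%:C + y%:C.
Proof. exact: rmorphD. Qed.

Lemma real_complexB (x y : R) : (x - y)%:C = x%:C - y%:C.
Proof. exact: rmorphB. Qed.

Lemma real_complexM (x y : R) : (x * y)%:C = x%:C * y%:C.
Proof. exact: rmorphM. Qed.

Lemma real_complexX (x : R) n : (x ^+ n)%:C = x%:C ^+ n.
Proof. exact: rmorphXn. Qed.

Lemma real_complex_nat n : n%:R%:C = n%:R :> R[i].
Proof. exact: rmorph_nat. Qed.

Lemma real_complex1 : 1%:C = 1 :> R[i].
Proof. by []. Qed.

Lemma norm_real_complex (x : R) : `|x%:C| = `|x|%:C.
Proof.
have [x0|x0] := leP 0 x; first by rewrite !ger0_norm // (lecR 0).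
by rewrite !ltr0_norm ?rmorphN // (ltcR _ 0).
Qed.

Lemma ge0_complex (x : R[i]) : 0 <= x -> x = (complex.Re x)%:C.
Proof. by move=> x0; rewrite RRe_real // ger0_real. Qed.

Lemma normE (V : normedModType R[i]) (x : V) : `|x| = (complex.Re `|x|)%:C.
Proof. exact: ge0_complex. Qed.

Lemma Re_ge0 (x : R[i]) : 0 <= x -> 0 <= complex.Re x.
Proof. by move=> x0; rewrite -lecR -ge0_complex // rmorph0. Qed.

Lemma norm_le_cvg0 (V : normedModType R[i]) (s : nat -> V) (l : V)
    (M a : R[i]) :
  s @ \oo --> l -> (forall n, `|a| <= M * `|l - s n|) -> a = 0.
Proof.
move=> /cvgrPdist_lt sl h; apply/eqP; rewrite -normr_eq0 eq_le normr_ge0 andbT.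
have {}h n : `|a| <= (`|M| + 1) * `|l - s n|.
  apply: le_trans (h n) _.
  have Mr : M * `|l - s n| \is Num.real.
    by apply: ger0_real; apply: le_trans (h n).
  apply: le_trans (real_ler_norm Mr) _; rewrite normrM normr_id.
  by apply: ler_wpM2r => //; rewrite lerDl.
have M0 : 0 < `|M| + 1 by rewrite ltr_wpDl.
rewrite real_leNgt ?realE ?normr_ge0 ?lexx //; apply/negP => a0.
have [n _ /(_ n (leqnn n))/= hn] := sl _ (divr_gt0 a0 M0).
suff : `|a| < `|a| by rewrite ltxx.
by apply: le_lt_trans (h n) _; rewrite mulrC -ltr_pdivlMr.
Qed.

Section Linear.
Context {U V : lmodType R[i]} (f : U -> V) (fl : linear f).

Lemma linear_fun0 : f 0 = 0.
Proof. by have := fl (-1) 0 0; rewrite scaler0 addr0 scaleN1r addNr. Qed.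

Lemma linear_funD x y : f (x + y) = f x + f y.
Proof. by have := fl 1 x y; rewrite !scale1r. Qed.

Lemma linear_funZ a x : f (a *: x) = a *: f x.
Proof. by have := fl a x 0; rewrite linear_fun0 !addr0. Qed.

Lemma linear_funN x : f (- x) = - f x.
Proof. by rewrite -scaleN1r linear_funZ scaleN1r. Qed.

Lemma linear_funB x y : f (x - y) = f x - f y.
Proof. by rewrite linear_funD linear_funN. Qed.

End Linear.

Lemma linear_comp (U V W : lmodType R[i]) (f : V -> W) (g : U -> V) :
  linear f -> linear g -> linear (f \o g).
Proof. by move=> fl gl a x y /=; rewrite gl fl. Qed.

Lemma linear_iter (V : lmodType R[i]) (f : V -> V) n :
  linear f -> linear (iter n f).
Proof. by move=> fl; elim: n => // n IH a x y /=; rewrite IH fl. Qed.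

Lemma bounded_operator_pos H K (f : H -> K) : bounded_operator f ->
  exists2 M : R, 0 < M & forall x, `|f x| <= M%:C * `|x|.
Proof.
move=> [_ [M h]]; exists (complex.Re `|M| + 1).
  by rewrite ltr_wpDl // Re_ge0.
move=> x; rewrite real_complexD real_complex1 -ge0_complex //; apply: le_trans (h x) _.
have Mr : M * `|x| \is Num.real.
  by apply: ger0_real; apply: le_trans (h x).
apply: le_trans (real_ler_norm Mr) _; rewrite normrM normr_id.
by apply: ler_wpM2r => //; rewrite lerDl.
Qed.

Lemma bounded_operator_comp H K (L : hilbertType R) (f : K -> L) (g : H -> K) :
  bounded_operator f -> bounded_operator g -> bounded_operator (f \o g).
Proof.
move=> fb gb; split; first exact: linear_comp fb.1 gb.1.
have [M M0 hM] := bounded_operator_pos fb.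
have [N N0 hN] := bounded_operator_pos gb.
exists (M%:C * N%:C) => x /=; apply: le_trans (hM _) _; rewrite -mulrA.
by apply: ler_wpM2l => //; rewrite lecR ltW.
Qed.

Lemma bounded_operator_iter H (f : H -> H) n :
  bounded_operator f -> bounded_operator (iter n f).
Proof.
move=> fb; elim: n => [|n IH]; last exact: bounded_operator_comp fb IH.
by split; [exact: (linear_iter 0 fb.1)|exists 1 => x; rewrite mul1r].
Qed.

Lemma bounded_operator_cvg H K (f : H -> K) T (F : set_system T)
    {FF : Filter F} (s : T -> H) (l : H) :
  bounded_operator f -> s @ F --> l -> (f \o s) @ F --> f l.
Proof.
move=> fb /cvgrPdist_lt sl; have [M M0 hM] := bounded_operator_pos fb.
have MC : 0 < M%:C by rewrite ltcR.
apply/cvgrPdist_lt => e e0.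
apply: filterS (sl _ (divr_gt0 e0 MC)) => x /=.
rewrite ltr_pdivlMr // mulrC => h; apply: le_lt_trans h.
by rewrite -(linear_funB fb.1); exact: hM.
Qed.

Lemma contraction_iter H (f : H -> H) n x :
  (forall x, `|f x| <= `|x|) -> `|iter n f x| <= `|x|.
Proof. by move=> h; elim: n => //= n IH; apply: le_trans IH. Qed.

(** * Projections onto closed subspaces, Riesz representation and adjoints *)

Definition seq_closed (V : normedModType R[i]) (A : set V) : Prop :=
  forall (s : nat -> V) l, (forall n, A (s n)) -> s @ \oo --> l -> A l.

Definition linear_subspace (V : lmodType R[i]) (A : set V) : Prop :=
  A 0 /\ forall a x y, A x -> A y -> A (a *: x + y).

Lemma linear_subspaceZ (V : lmodType R[i]) (A : set V) a x :
  linear_subspace A -> A x -> A (a *: x).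
Proof. by move=> [A0 h] Ax; rewrite -[_ *: _]addr0; exact: h. Qed.

Lemma linear_subspaceB (V : lmodType R[i]) (A : set V) x y :
  linear_subspace A -> A x -> A y -> A (x - y).
Proof. by move=> [A0 h] Ax Ay; rewrite addrC -scaleN1r; exact: h. Qed.

Lemma parallelogram H (x y : H) :
  `|x + y| ^+ 2 + `|x - y| ^+ 2 = 2 * (`|x| ^+ 2 + `|y| ^+ 2).
Proof.
by rewrite -!inner_normE !(innerDl, innerDr, innerNl, innerNr); ring.
Qed.

Lemma Re_norm_cvg (V : normedModType R[i]) (s : nat -> V) (l : V) :
  s @ \oo --> l -> (fun n => complex.Re `|s n|) @ \oo --> complex.Re `|l|.
Proof.
move=> /cvgrPdist_lt sl; apply/cvgrPdist_lt => e e0.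
have eC : 0 < e%:C by rewrite ltcR.
apply: filterS (sl _ eC) => n /= h; rewrite -ltcR; apply: le_lt_trans h.
by rewrite -norm_real_complex real_complexB -!normE; exact: ler_dist_dist.
Qed.

Lemma cauchy_seq_cvg H (s : nat -> H) (b : nat -> R) :
  (forall n m, (n <= m)%N -> `|s n - s m| <= (b n)%:C) -> b @ \oo --> (0 : R) ->
  cvgn s.
Proof.
move=> sb /cvgrPdist_lt b0; apply/cauchy_cvgP/cauchy_exP => e e0.
have e'0 : 0 < complex.Re e by rewrite -ltcR -ge0_complex // ltW.
have [N _ hN] := b0 _ e'0; exists (s N); exists N => // m /= Nm.
rewrite -ball_normE /=; apply: le_lt_trans (sb _ _ Nm) _.
rewrite [X in _ < X](ge0_complex (ltW e0)) ltcR.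
have /= := hN N (leqnn N); rewrite sub0r normrN; apply: le_lt_trans.
exact: ler_norm.
Qed.

Lemma orthogonal_projection H (W : set H) : linear_subspace W -> seq_closed W ->
  forall x, exists2 w, W w & forall z, W z -> inner z (x - w) = 0.
Proof.
move=> Ws Wc x.
pose q w : R := complex.Re (`|x - w| ^+ 2).
have qE w : `|x - w| ^+ 2 = (q w)%:C by rewrite -ge0_complex ?exprn_ge0.
have q0 w : 0 <= q w by rewrite -lecR -qE exprn_ge0.
pose d := inf (q @` W).
have hi : has_inf (q @` W).
  by split; [exists (q 0), 0 => //; exact: Ws.1|exists 0 => _ [w _ <-]].
have dle w : W w -> d <= q w by move=> Ww; apply: ge_inf; [exact: hi.2|exists w].
have /choice[s hs] : forall n, exists w, W w /\ q w < d + n.+1%:R^-1.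
  move=> n; have [|_ [w Ww <-] hw] := @inf_adherent _ _ (n.+1%:R^-1 : R) _ hi.
    by rewrite invr_gt0 ltr0n.
  by exists w.
(* Parallelogram law at [x - s n] and [x - s m]: the midpoint of [s n] and [s m] lies in [W], so its
   [q] is at least [d], and [|s n - s m|^2 <= 2 (2 d + 1/(n+1) + 1/(m+1)) - 4 d <= 4/(n+1)]. *)
have scauchy n m : (n <= m)%N ->
    `|s n - s m| <= (Num.sqrt (4 * n.+1%:R^-1))%:C.
  move=> nm; rewrite -(@ler_pXn2r _ 2) ?nnegrE ?lecR ?sqrtr_ge0 //.
  rewrite -real_complexX sqr_sqrtr ?mulr_ge0 ?invr_ge0 //.
  have := parallelogram (x - s n) (x - s m).
  have -> : x - s n + (x - s m) = 2 *: (x - 2^-1 *: (s n + s m)).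
    rewrite scalerBr scalerA divff ?scale1r ?pnatr_eq0 // scaler_nat mulr2n.
    by rewrite opprD addrACA.
  have -> : x - s n - (x - s m) = - (s n - s m).
    by rewrite opprB [LHS]addrC subrKA opprB.
  rewrite normrN normrZ exprMn !qE ger0_norm ?ler0n //.
  set p := q (_ *: _).
  have dp : d <= p.
    apply: dle; apply: linear_subspaceZ => //; rewrite -[s n]scale1r.
    by apply: Ws.2; [case: (hs n)|case: (hs m)].
  have {}hsn := (hs n).2; have {}hsm := (hs m).2.
  have mn : m.+1%:R^-1 <= n.+1%:R^-1 :> R by rewrite lef_pV2 ?posrE ?ltr0n // ler_nat.
  move=> /(canRL (addKr _)) ->.
  have -> : - (2 ^+ 2 * p%:C) + 2 * ((q (s n))%:C + (q (s m))%:C) =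
     (2 * (q (s n) + q (s m)) - 4 * p)%:C.
    by rewrite !(real_complexB, real_complexM, real_complexD, real_complex_nat); ring.
  rewrite lecR; move: dp hsn hsm mn; set u := n.+1%:R^-1; set v := m.+1%:R^-1; lra.
have /cvg_ex[w sw] : cvgn s.
  apply: (cauchy_seq_cvg scauchy).
  rewrite -(sqrtr0 R); apply: continuous_cvg; first exact: sqrt_continuous.
  rewrite -(mulr0 4); apply: cvgMr; exact: cvg_harmonic.
have Ww : W w by apply: Wc sw => n; case: (hs n).
have qw : q w <= d.
  have sw' : (fun n => x - s n) @ \oo --> x - w by apply: cvgB => //; exact: cvg_cst.
  have qs : (fun n => q (s n)) @ \oo --> q w.
    have := Re_norm_cvg sw'; rewrite /q => h.
    have qsqr (v : H) : complex.Re (`|v| ^+ 2) = complex.Re `|v| * complex.Re `|v|.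
      by rewrite [in LHS]normE -real_complexX expr2.
    by rewrite qsqr; under eq_fun do rewrite qsqr; exact: cvgM.
  apply: (ler_cvg_to qs (_ : (fun n => d + n.+1%:R^-1) @ \oo --> d)).
    rewrite -[X in _ --> X]addr0; apply: cvgD; first exact: cvg_cst.
    exact: cvg_harmonic.
  by near=> n; apply/ltW; case: (hs n).
exists w => // z Wz; apply/eqP; rewrite -normr_eq0; apply/eqP.
have [->|z0] := eqVneq z 0; first by rewrite inner0l normr0.
(* Minimality of [w] is tested against [w + a z], [a = <x - w, z> / |z|^2]. *)
pose zz := inner z z; have zz0 : 0 < zz.
  by rewrite /zz inner_normE exprn_gt0 // normr_gt0.
pose a := inner (x - w) z / zz.
have Wa : W (a *: z + w) by exact: Ws.2.
have := le_trans qw (dle _ Wa).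
rewrite -lecR -!qE opprD addrCA addrC -!inner_normE.
rewrite !(innerDl (x - w)) !(innerDr (x - w)) !innerNl !innerNr !innerZl !innerZr.
rewrite (innerC z (x - w)) -/zz.
have za : Num.conj a = Num.conj (inner (x - w) z) / zz.
  by rewrite rmorphM fmorphV /= -[Num.conj zz](innerC z z).
rewrite za /a; set c := inner (x - w) z.
have -> : inner (x - w) (x - w) - Num.conj c / zz * c +
   (- (c / zz * Num.conj c) - - (c / zz * (Num.conj c / zz * zz))) =
   inner (x - w) (x - w) - (c * Num.conj c) / zz.
  by field; rewrite gt_eqF.
rewrite -normCK lerDl oppr_ge0 pmulr_lle0 ?invr_gt0 //.
move=> h; apply/eqP; rewrite norm_conjC -sqrf_eq0 eq_le h /=.
by rewrite exprn_ge0.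
Unshelve. all: by end_near.
Qed.

Lemma Riesz_representation H (f : H -> R[i]) (M : R[i]) :
  (forall a x y, f (a *: x + y) = a * f x + f y) ->
  (forall x, `|f x| <= M * `|x|) ->
  exists y, forall x, f x = inner x y.
Proof.
move=> fl fM.
have f0 : f 0 = 0.
  by have := fl (-1) 0 0; rewrite scaler0 addr0 mulN1r addNr.
have [h|/existsNP[x0 fx0]] := pselect (forall x, f x = 0).
  by exists 0 => x; rewrite h inner0r.
have fB a x y : f (x - a *: y) = f x - a * f y.
  by rewrite addrC -scaleNr fl mulNr addrC.
have Ks : linear_subspace [set x | f x = 0].
  by split=> //= a x y fx fy; rewrite fl fx fy mulr0 addr0.
have Kc : seq_closed [set x | f x = 0].
  move=> s l hs sl; apply: (norm_le_cvg0 (M := M) sl) => n.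
  by apply: le_trans (fM _); rewrite -[s n]scale1r fB (hs n) mulr0 subr0.
have [w fw hw] := orthogonal_projection Ks Kc x0.
pose v := x0 - w; have fv : f v != 0.
  by rewrite /v -[w]scale1r fB fw mulr0 subr0; apply/eqP.
have vv : inner v v != 0.
  by apply: contra fv => /eqP/inner_eq0 ->; rewrite f0.
exists (Num.conj (f v / inner v v) *: v) => x.
rewrite innerZr conjCK.
have : inner (x - (f x / f v) *: v) v = 0.
  by apply: hw; rewrite /= fB divfK // subrr.
by rewrite innerBl innerZl => /subr0_eq ->; field; rewrite vv fv.
Qed.

Section Adjoint.
Context {H K : hilbertType R} (T : H -> K).

Lemma adjoint_unique S :
  (forall x y, inner (T x) y = inner x (S y)) -> adjoint T = S.
Proof.
move=> hS; rewrite /adjoint; case: xgetP => [S' _ /= hS'|/(_ S)//].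
by apply/funext => y; apply: inner_ext => x; rewrite -hS' hS.
Qed.

Hypothesis Tb : bounded_operator T.

Lemma adjointE x y : inner (T x) y = inner x (adjoint T y).
Proof.
have [M hM] := Tb.2; have Tl := Tb.1.
have /choice[S hS] : forall y, exists z, forall x, inner (T x) y = inner x z.
  move=> z; apply: (@Riesz_representation _ _ (M * `|z|)) => [a u v|u].
    by rewrite Tl innerDl innerZl.
  apply: le_trans (inner_CauchySchwarz _ _) _.
  by rewrite mulrAC ler_wpM2r.
by rewrite (@adjoint_unique S).
Qed.

Lemma adjointEl x y : inner (adjoint T y) x = inner y (T x).
Proof. by rewrite innerC -adjointE -innerC. Qed.

Lemma adjoint_linear : linear (adjoint T).
Proof.
move=> a x y; apply: inner_ext => z.
by rewrite -adjointE !innerDr !innerZr !adjointE.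
Qed.

End Adjoint.

Lemma adjoint_contraction H (T : H -> H) x :
  contraction T -> `|adjoint T x| <= `|x|.
Proof.
move=> [Tb Tc]; have [->|y0] := eqVneq (adjoint T x) 0; first by rewrite normr0.
have y_gt0 : 0 < `|adjoint T x| by rewrite normr_gt0.
rewrite -(ler_pM2l y_gt0) -expr2 -inner_normE (adjointEl Tb).
rewrite -[inner _ _]ger0_norm; last by rewrite -(adjointEl Tb) inner_ge0.
apply: le_trans (inner_CauchySchwarz _ _) _.
by rewrite mulrC ler_wpM2r.
Qed.

Lemma adjoint_bounded H (T : H -> H) : contraction T -> bounded_operator (adjoint T).
Proof.
move=> Tc; split; first exact: adjoint_linear Tc.1.
by exists 1 => x; rewrite mul1r adjoint_contraction.
Qed.

Lemma adjoint_iterE H (T : H -> H) n x y : bounded_operator T ->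
  inner (iter n T x) y = inner x (iter n (adjoint T) y).
Proof.
move=> Tb; elim: n x y => // n IH x y.
by rewrite iterSr IH (adjointE Tb) -iterS.
Qed.

(** * Positive operators and uniqueness of the square root *)

Section PositiveOperators.
Context {H : hilbertType R}.
Implicit Types A P D S : H -> H.

(** The values of the quadratic form are real. Reality at [x + y] gives the imaginary part of
    [<A x, y> = conj <A y, x>], and reality at ['i *: x + y] gives the real part. *)
Lemma positive_operator_sym A : linear A -> positive_operator A ->
  forall x y, inner (A x) y = inner x (A y).
Proof.
move=> Al A0 x y; rewrite [RHS]innerC.
set p := inner (A x) y; set s := inner (A y) x.
have rl z : Num.conj (inner (A z) z) = inner (A z) z.
  by apply/CrealP/ger0_real.
have h1 := rl (x + y); have h2 := rl ('i *: x + y).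
move: h1 h2; rewrite (linear_funD Al) Al !innerDl !innerDr !innerZl !innerZr.
rewrite -/p -/s !(conjCi, rmorphD, rmorphM, rmorphN) /= !rl !conjCi.
have key (a b t t' u u' i : R[i]) : a + t' + (u' + b) = a + t + (u + b) ->
    - i * (- - i * a) + - i * t' + (- - i * u' + b) =
    i * (- i * a) + i * t + (- i * u + b) -> 2 * i * (t - u') = 0.
  move=> h1 h2.
  have -> : 2 * i * (t - u') = (i * (- i * a) + i * t + (- i * u + b) -
      (- i * (- - i * a) + - i * t' + (- - i * u' + b))) +
      i * (a + t + (u + b) - (a + t' + (u' + b))) by ring.
  by rewrite h1 h2 !subrr mulr0 addr0.
move=> h1 h2; have /eqP := key _ _ _ _ _ _ _ h1 h2.
by rewrite !mulf_eq0 subr_eq0 (negPf (neq0Ci _)) pnatr_eq0 /= => /eqP.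
Qed.

Lemma positive_operator_CauchySchwarz A : linear A -> positive_operator A ->
  forall x y, `|inner (A x) y| ^+ 2 <= inner (A x) x * inner (A y) y.
Proof.
move=> Al A0; apply: (psd_form_CauchySchwarz (f := fun x y => inner (A x) y)).
- by move=> a x y z; rewrite Al innerDl innerZl.
- by move=> x y; rewrite positive_operator_sym // -innerC.
- exact: A0.
Qed.

Lemma positive_operator_eq0 A : linear A -> positive_operator A ->
  forall x, inner (A x) x = 0 -> A x = 0.
Proof.
move=> Al A0 x h; apply: inner_eq0; apply/eqP; rewrite -normr_eq0 -sqrf_eq0.
rewrite eq_le exprn_ge0 // andbT.
by apply: le_trans (positive_operator_CauchySchwarz Al A0 _ _) _; rewrite h mul0r.
Qed.

Lemma natmul_bounded_eq0 (a b : R[i]) :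
  0 <= a -> (forall n, n%:R * a <= b) -> a = 0.
Proof.
move=> a0 h; have b0 : 0 <= b by rewrite -(mul0r a) (h 0).
rewrite (ge0_complex a0); congr (_%:C).
move: (Re_ge0 a0) h; rewrite (ge0_complex a0) (ge0_complex b0) /=.
set r := complex.Re a; set q := complex.Re b => r0 h.
apply/eqP; rewrite eq_le r0 andbT leNgt; apply/negP => r_gt0.
have := archi_boundP (divr_ge0 (Re_ge0 b0) r0).
set n := Num.bound _; rewrite ltr_pdivrMr // ltNge => /negP; apply.
by rewrite -lecR real_complexM real_complex_nat.
Qed.

(* If [P D = - D P] then [(1 + P)^n D = D (1 - P)^n] is bounded in [n], while
   [|(1 + P)^n y|^2] grows at least like [2 n <P y, y>]. *)
Lemma anticommuting_positive P D : linear P -> positive_operator P ->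
  (forall x, `|P x| <= `|x|) -> bounded_operator D ->
  (forall x, P (D x) = - D (P x)) ->
  forall x, inner (P (D x)) (D x) = 0.
Proof.
move=> Pl P0 Pc Db PD x; have [M M0 hM] := bounded_operator_pos Db.
have Dl := Db.1; have CS := positive_operator_CauchySchwarz Pl P0.
pose Ap y := y + P y; pose Am y := y - P y.
have AmE y : `|Am y| <= `|y|.
  rewrite -(@ler_pXn2r _ 2) ?nnegrE // -!inner_normE /Am.
  rewrite innerBl !innerBr -(positive_operator_sym Pl P0).
  (* This is [P^2 <= P] for a positive contraction: Cauchy-Schwarz for the form of [P] bounds
     [|P y|^4] by [<P y, y> <P (P y), P y>], and the last factor is at most [|P y|^2]. *)
  have PyPy : inner (P y) (P y) <= inner (P y) y.
    have [->|Py0] := eqVneq (P y) 0; first by rewrite !inner0l.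
    have PP0 : 0 < inner (P y) (P y) by rewrite inner_normE exprn_gt0 ?normr_gt0.
    rewrite -(ler_pM2r PP0) -expr2.
    apply: (@le_trans _ _ (`|inner (P y) (P y)| ^+ 2)).
      by rewrite ger0_norm // ltW.
    apply: le_trans (CS _ _) _; apply: ler_wpM2l; first exact: P0.
    rewrite -[leLHS]ger0_norm ?P0 //; apply: le_trans (inner_CauchySchwarz _ _) _.
    by rewrite inner_normE expr2 ler_wpM2r.
  rewrite opprB addrA -subr_ge0.
  have -> : inner y y - (inner y y - inner (P y) y + inner (P y) (P y) - inner (P y) y) =
     inner (P y) y + (inner (P y) y - inner (P y) (P y)) by ring.
  by rewrite addr_ge0 ?subr_ge0 ?P0.
have ApD n : iter n Ap (D x) = D (iter n Am x).
  elim: n => //= n ->; rewrite /Ap /Am (linear_funB Dl) PD; done.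
(* Since [|y + P y|^2 = |y|^2 + 2 <P y, y> + |P y|^2], one step gains at least [2 <P y, y>]. The
   second conjunct, monotonicity of [<P y, y>] along the iteration, keeps this gain from
   shrinking. *)
have Apn n : inner (D x) (D x) + 2 * n%:R * inner (P (D x)) (D x) <=
    inner (iter n Ap (D x)) (iter n Ap (D x)) /\
    inner (P (D x)) (D x) <= inner (P (iter n Ap (D x))) (iter n Ap (D x)).
  elim: n => [|n [IH1 IH2]]; first by rewrite mulr0 mul0r addr0.
  move: IH1 IH2 => /=; set y := iter n Ap (D x); rewrite /Ap.
  rewrite (linear_funD Pl) !innerDl !innerDr.
  rewrite -(positive_operator_sym Pl P0 y) (positive_operator_sym Pl P0 (P y) y).
  set p := inner (P (D x)) (D x) => IH1 IH2.
  have PP := inner_ge0 (P y); have PPP := P0 (P y); split.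
    rewrite -[n.+1]addn1 natrD mulrDr mulrDl mulr1 addrA.
    apply: le_trans (lerD IH1 (_ : _ <= 2 * inner (P y) y)) _.
      by rewrite ler_wpM2l.
    rewrite -subr_ge0.
    by rewrite [X in 0 <= X](_ : _ = inner (P y) (P y)) //; ring.
  apply: le_trans IH2 _; rewrite -subr_ge0.
  rewrite [X in 0 <= X](_ : _ = 2 * inner (P y) (P y) + inner (P (P y)) (P y)).
    by rewrite addr_ge0 // mulr_ge0.
  by ring.
apply: (@natmul_bounded_eq0 _ ((M%:C * `|x|) ^+ 2)); first exact: P0.
move=> n; have [h _] := Apn n.
apply: (@le_trans _ _ (inner (iter n Ap (D x)) (iter n Ap (D x)))).
  apply: le_trans h; rewrite -subr_ge0.
  rewrite [X in 0 <= X](_ : _ = inner (D x) (D x) + n%:R * inner (P (D x)) (D x)).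
    by rewrite addr_ge0 ?inner_ge0 // mulr_ge0 // P0.
  by ring.
have MC : 0 <= M%:C by rewrite (lecR 0) ltW.
rewrite ApD inner_normE ler_pXn2r ?nnegrE ?mulr_ge0 //.
apply: le_trans (hM _) _; rewrite ler_pM2l ?(ltcR 0) //.
by elim: n {h} => //= n IH; apply: le_trans (AmE _) IH.
Qed.

(** The two roots are not known to commute, but equality of their squares makes [S + S'] anticommute
    with [D = S - S']. The previous lemma then gives [<(S + S') D x, D x> = 0]. Both summands are
    non-negative, so [S] and [S'] kill the range of [D]. Thus [D] squares to zero, and being
    symmetric it vanishes. The factor [c] only makes [P] a contraction. *)
Lemma positive_sqrt_unique S S' :
  bounded_operator S -> positive_operator S ->
  bounded_operator S' -> positive_operator S' ->
  S \o S = S' \o S' -> S = S'.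
Proof.
move=> Sb S0 S'b S'0 SS; have SSx x : S (S x) = S' (S' x) by exact: (congr1 (@^~ x) SS).
have Sl := Sb.1; have S'l := S'b.1.
have [M M0 hM] := bounded_operator_pos Sb.
have [N N0 hN] := bounded_operator_pos S'b.
pose c : R[i] := (M + N)%:C^-1; pose P x := c *: (S x + S' x); pose D x := S x - S' x.
have MN : 0 < (M + N)%:C by rewrite (ltcR 0) addr_gt0.
have c0 : 0 < c by rewrite invr_gt0.
have Pl : linear P.
  by move=> a x y; rewrite /P Sl S'l !scalerDr !scalerA ![c * a]mulrC addrACA.
have Dl : linear D.
  by move=> a x y; rewrite /D Sl S'l opprD addrACA scalerBr.
have P0 : positive_operator P.
  move=> x; rewrite innerZl innerDl; apply: mulr_ge0; first exact: ltW.
  by apply: addr_ge0; [exact: S0|exact: S'0].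
have Pc x : `|P x| <= `|x|.
  rewrite normrZ gtr0_norm // ler_pdivrMl // real_complexD mulrDl.
  by apply: le_trans (ler_normD _ _) _; apply: lerD.
have Db : bounded_operator D.
  split=> //; exists (M + N)%:C => x; rewrite real_complexD mulrDl.
  by apply: le_trans (ler_normB _ _) _; apply: lerD.
have PD x : P (D x) = - D (P x).
  rewrite /P /D !(linear_funZ Sl) !(linear_funZ S'l) -scalerBr -scalerN.
  congr (_ *: _).
  rewrite !(linear_funB Sl, linear_funB S'l, linear_funD Sl, linear_funD S'l).
  rewrite SSx opprB; set a := S' (S' x); set u := S (S' x); set v := S' (S x).
  by rewrite [LHS]addrC subrKA opprD addrA addrK.
have Dsym x y : inner (D x) y = inner x (D y).
  by rewrite innerBl innerBr !positive_operator_sym.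
have DD x : D (D x) = 0.
  have := anticommuting_positive Pl P0 Pc Db PD x.
  rewrite innerZl innerDl => /eqP; rewrite mulf_eq0 gt_eqF //=.
  rewrite paddr_eq0 ?S0 ?S'0 // => /andP[/eqP h /eqP h'].
  rewrite {1}/D (positive_operator_eq0 Sl S0 h).
  by rewrite (positive_operator_eq0 S'l S'0 h') subrr.
apply/funext => x; apply/eqP; rewrite -subr_eq0; apply/eqP/inner_eq0.
by rewrite -/(D x) Dsym DD inner0r.
Qed.

End PositiveOperators.

End Hilbert.

(** * Sequences, isometries and power series *)

Section Sequences.
Context {R : realType}.
Implicit Types H K : hilbertType R.

Lemma closure_normP (V : normedModType R[i]) (A : set V) x :
  closure A x <-> forall e : R[i], 0 < e -> exists2 a, A a & `|x - a| < e.
Proof.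
split=> [cA e e0|h B /nbhs_ballP[e /= e0 eB]].
  have [a [Aa]] := cA _ (nbhsx_ballx x e e0).
  by rewrite -ball_normE /= => xa; exists a.
have [a Aa xa] := h _ e0; exists a; split=> //; apply: eB.
by rewrite -ball_normE.
Qed.

Lemma closure_linear_subspace (V : normedModType R[i]) (A : set V) :
  linear_subspace A -> linear_subspace (closure A).
Proof.
move=> [A0 Al]; split; first exact: subset_closure.
move=> a x y /closure_normP hx /closure_normP hy; apply/closure_normP => e e0.
have a1 : 0 < `|a| + 1 by rewrite ltr_wpDl.
have e2 : 0 < e / 2 by rewrite divr_gt0.
have [x' Ax' xx'] := hx _ (divr_gt0 e2 a1).
have [y' Ay' yy'] := hy _ e2.
exists (a *: x' + y'); first exact: Al.
rewrite opprD addrACA -scalerBr; apply: le_lt_trans (ler_normD _ _) _.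
rewrite [ltRHS]splitr normrZ; apply: ler_ltD yy'.
apply: (@le_trans _ _ ((`|a| + 1) * `|x - x'|)).
  by apply: ler_wpM2r => //; rewrite lerDl.
by move: xx'; rewrite ltr_pdivlMr // mulrC => /ltW.
Qed.

Lemma closure_seq_closed (V : normedModType R[i]) (A : set V) :
  seq_closed (closure A).
Proof.
move=> s l As sl; apply: (@closed_cvg _ _ _ _ s (closure A) _ _ l sl).
  exact: closed_closure.
by apply: nearW.
Qed.

Lemma range_linear_subspace (U V : lmodType R[i]) (f : U -> V) :
  linear f -> linear_subspace (range f).
Proof.
move=> fl; split; first by exists 0 => //; exact: linear_fun0.
by move=> a _ _ [x _ <-] [y _ <-]; exists (a *: x + y) => //; exact: fl.
Qed.

Lemma linear_subspace_series (V : normedModType R[i]) (A : set V)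
    (u : nat -> V) n :
  linear_subspace A -> (forall k, A (u k)) -> A (series u n).
Proof.
move=> As Au; elim: n => [|n IH]; first by rewrite seriesEnat /= big_geq //; exact: As.1.
rewrite seriesSr -[u n]scale1r addrC; exact: As.2.
Qed.

Section UnitaryBetween.
Context {H K : hilbertType R} (A : set H) (B : set K) (u : H -> K).
Hypotheses (As : linear_subspace A) (hu : unitary_between A inner B inner u).

Lemma unitary_between_lin a x y : A x -> A y -> u (a *: x + y) = a *: u x + u y.
Proof. by case: hu => ul _ _; exact: ul. Qed.

Lemma unitary_between_inner x y : A x -> A y -> inner (u x) (u y) = inner x y.
Proof. by case: hu => _ ui _; exact: ui. Qed.

Lemma unitary_between_mem x : A x -> B (u x).
Proof. by case: hu => _ _ <- Ax; exists x. Qed.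

Lemma unitary_between0 : u 0 = 0.
Proof.
have A0 := As.1; have := unitary_between_lin (-1) A0 A0.
by rewrite scaler0 addr0 scaleN1r addNr.
Qed.

Lemma unitary_betweenZ a x : A x -> u (a *: x) = a *: u x.
Proof.
by move=> Ax; have := unitary_between_lin a Ax As.1; rewrite unitary_between0 !addr0.
Qed.

Lemma unitary_betweenD x y : A x -> A y -> u (x + y) = u x + u y.
Proof. by move=> Ax /(unitary_between_lin 1 Ax); rewrite !scale1r. Qed.

Lemma unitary_betweenB x y : A x -> A y -> u (x - y) = u x - u y.
Proof.
move=> Ax Ay; rewrite addrC -scaleN1r unitary_between_lin //.
by rewrite scaleN1r addrC.
Qed.

Lemma unitary_between_norm x : A x -> `|u x| = `|x|.
Proof.
move=> Ax; apply/eqP; rewrite -(@eqrXn2 _ 2) // -!inner_normE.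
by rewrite unitary_between_inner.
Qed.

Lemma unitary_between_series (s : nat -> H) n :
  (forall k, A (s k)) -> u (series s n) = series (fun k => u (s k)) n.
Proof.
move=> sA; elim: n => [|n IH].
  by rewrite !seriesEnat /= !big_geq // unitary_between0.
rewrite !seriesSr unitary_betweenD ?IH //; exact: linear_subspace_series.
Qed.

Lemma unitary_between_cvg (s : nat -> H) l :
  (forall n, A (s n)) -> A l -> s @ \oo --> l -> (fun n => u (s n)) @ \oo --> u l.
Proof.
move=> sA Al /cvgrPdist_lt sl; apply/cvgrPdist_lt => e e0.
apply: filterS (sl _ e0) => n.
by rewrite -unitary_betweenB // unitary_between_norm //; exact: linear_subspaceB.
Qed.

Lemma unitary_between_inverse : exists v : K -> H,
  [/\ unitary_between B inner A inner v,
      forall x, A x -> v (u x) = x & forall y, B y -> u (v y) = y].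
Proof.
have uB := hu; case: uB => _ _ uB.
have /choice[v hv] : forall y, exists x, B y -> A x /\ u x = y.
  move=> y; have [|nB] := pselect (B y); last by exists 0.
  by rewrite -uB => -[x Ax <-]; exists x.
have vu x : A x -> v (u x) = x.
  move=> Ax; have [Av uv] := hv _ (unitary_between_mem Ax).
  apply/eqP; rewrite -subr_eq0 -normr_eq0 -unitary_between_norm; last first.
    exact: linear_subspaceB.
  by rewrite unitary_betweenB // uv subrr normr0.
have uv y : B y -> u (v y) = y by move=> /hv[].
exists v; split=> //; split.
- move=> a x y Bx By; have [Ax ux] := hv _ Bx; have [Ay uy] := hv _ By.
  rewrite -{1}ux -{1}uy -unitary_between_lin // vu //; exact: As.2.
- move=> x y Bx By; have [Ax ux] := hv _ Bx; have [Ay uy] := hv _ By.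
  by rewrite -unitary_between_inner // ux uy.
- apply/seteqP; split=> [_ [y By <-]|x Ax]; first by case: (hv _ By).
  by exists (u x); [exact: unitary_between_mem|exact: vu].
Qed.

End UnitaryBetween.

Lemma linear_subspaceT (V : lmodType R[i]) : linear_subspace [set: V].
Proof. by []. Qed.

Lemma unitary_inverse H K (u : H -> K) : unitary u ->
  exists v : K -> H, [/\ unitary v, cancel u v & cancel v u].
Proof.
move=> uu; have [v [vu vK uK]] := unitary_between_inverse (linear_subspaceT _) uu.
by exists v; split=> // x; [exact: vK|exact: uK].
Qed.

Lemma unitary_linear H K (u : H -> K) : unitary u -> linear u.
Proof. by case=> ul _ _ a x y; exact: ul. Qed.

Lemma unitary_norm H K (u : H -> K) x : unitary u -> `|u x| = `|x|.
Proof. by move=> uu; exact: (unitary_between_norm uu). Qed.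

Lemma unitary_inner H K (u : H -> K) x y : unitary u -> inner (u x) (u y) = inner x y.
Proof. by move=> uu; exact: (unitary_between_inner uu). Qed.

Lemma unitary_bounded H K (u : H -> K) : unitary u -> bounded_operator u.
Proof.
move=> uu; split; first exact: unitary_linear.
by exists 1 => x; rewrite mul1r unitary_norm.
Qed.

Lemma cvg_series_dominated H (u : nat -> H) (b : nat -> R) :
  (forall n, `|u n| <= (b n)%:C) -> cvgn (series b) -> cvgn (series u).
Proof.
move=> ub /cauchy_cvgP/cauchy_seriesP bc; apply/cauchy_cvgP/cauchy_seriesP => e e0.
have e'0 : 0 < complex.Re e by rewrite -ltcR -ge0_complex // ltW.
apply: filterS (bc _ e'0) => -[n m] /= h.
rewrite (ge0_complex (ltW e0)); apply: le_lt_trans (ler_norm_sum _ _ _) _.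
rewrite -ltcR in h; apply: le_lt_trans h; rewrite -norm_real_complex.
rewrite raddf_sum; apply: le_trans (ler_sum _ (fun k _ => ub k)) _.
rewrite ger0_norm //; apply: sumr_ge0 => k _.
exact: le_trans (ub k).
Qed.

Lemma cvg_norm_bounded (V : normedModType R[i]) (s : nat -> V) :
  cvgn s -> exists M, forall n, `|s n| <= M.
Proof.
move=> /cvg_seq_bounded[M [_ hM]]; exists (M + 1) => n.
by apply: hM => //; rewrite ltrDl.
Qed.

(** * Uniqueness of power series coefficients *)

Section PowerSeries.
Context (V : normedModType R[i]).
Implicit Types a : nat -> V.

(** The point [z = 0], where the series is just [a 0], is excluded because the induction in
    [power_series_eq0] divides by [z]. So [a 0] is reached by letting a real [t > 0] tend to [0]. *)
Lemma power_series_head_eq0 a :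
  (forall z : R[i], 0 < `|z| < 1 ->
     series (fun n => z ^+ n *: a n) @ \oo --> (0 : V)) ->
  a 0%N = 0.
Proof.
move=> ha.
have n2 : `|2^-1 : R[i]| = 2^-1 by rewrite ger0_norm.
have := ha 2^-1; rewrite n2 invr_gt0 ltr0n invf_lt1 ?ltr0n // ltr1n => /(_ isT) h2.
have /cvgP/cvg_norm_bounded[M hM] := cvg_series_cvg_0 (cvgP _ h2).
have {}hM n : `|a n| <= M * 2 ^+ n.
  have := hM n; rewrite normrZ normrX n2 exprVn.
  by rewrite ler_pdivrMl ?exprn_gt0 // mulrC.
have M0 : 0 <= M by have := hM 0%N; rewrite expr0 mulr1; exact: le_trans.
(* Convergence at [1/2] gave [|a n| <= M 2^n]. For [t <= 1/4] the tail is therefore at most [2 M t]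
   times a partial sum of the geometric series of ratio [1/2], which is [2 (1 - 2^-N)]. *)
have tail (t : R[i]) N : 0 <= t -> t <= 4^-1 ->
    `|series (fun n => t ^+ n *: a n) N.+1 - a 0%N| <= 4 * M * t * (1 - 2^-1 ^+ N).
  move=> t0 t4; elim: N => [|N IH].
    by rewrite seriesSr seriesEnat /= big_geq // add0r expr0 scale1r !subrr normr0 mulr0.
  rewrite seriesSr addrAC; apply: le_trans (ler_normD _ _) _.
  apply: (@le_trans _ _ (4 * M * t * (1 - 2^-1 ^+ N) + M * (2 * t) * 2^-1 ^+ N)).
    apply: lerD => //; rewrite normrZ normrX ger0_norm //.
    apply: (@le_trans _ _ (t ^+ N.+1 * (M * 2 ^+ N.+1))).
      by apply: ler_wpM2l => //; exact: exprn_ge0.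
    have -> : t ^+ N.+1 * (M * 2 ^+ N.+1) = M * (2 * t) * (2 * t) ^+ N.
      by rewrite exprMn !exprS; ring.
    apply: ler_wpM2l; first by rewrite !mulr_ge0.
    apply: lerXn2r; rewrite ?nnegrE ?mulr_ge0 ?invr_ge0 //.
    by rewrite -ler_pdivlMl // -invfM -natrM.
  rewrite [leRHS](_ : _ = 4 * M * t * (1 - 2^-1 ^+ N) + M * (2 * t) * 2^-1 ^+ N) //.
  by rewrite exprS; field.
apply/eqP; rewrite -normr_eq0; apply/eqP.
apply: (@natmul_bounded_eq0 _ _ (M + 1)) => // k.
have k0 : 0 < k.+1%:R :> R[i] by rewrite ltr0n.
(* Chosen so that the tail bound [4 M t] becomes [M / (k+1)]. *)
pose t : R[i] := (4 * k.+1%:R)^-1.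
have t0 : 0 < t by rewrite invr_gt0 mulr_gt0.
have t4 : t <= 4^-1.
  by rewrite lef_pV2 ?posrE ?mulr_gt0 // ler_peMr // ler1n.
have tt : 0 < `|t| < 1.
  rewrite gtr0_norm // t0 /=; apply: le_lt_trans t4 _.
  by rewrite invf_lt1 // ltr1n.
have /cvgrPdist_lt/(_ (k.+1%:R^-1)) := ha t tt; rewrite invr_gt0 => /(_ k0)[N _ hN].
have := hN N.+1 (leqnSn N); rewrite /= sub0r normrN => {}hN.
have {}hN : `|a 0%N| <= k.+1%:R^-1 + 4 * M * t.
  rewrite -[a 0%N](subKr (series (fun n => t ^+ n *: a n) N.+1)).
  apply: le_trans (ler_normB _ _) _; apply: lerD; first exact: ltW.
  apply: le_trans (tail t N (ltW t0) t4) _.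
  rewrite ler_piMr ?mulr_ge0 ?(ltW t0) // gerBl exprn_ge0 //.
apply: (@le_trans _ _ (k.+1%:R * `|a 0%N|)).
  by apply: ler_wpM2r => //; rewrite ler_nat.
rewrite mulrC -ler_pdivlMr //; apply: le_trans hN _.
suff -> : k.+1%:R^-1 + 4 * M * t = (M + 1) / k.+1%:R by [].
rewrite /t invfM; set q := k.+1%:R^-1; have q4 : 4 * 4^-1 = 1 :> R[i] by rewrite divff.
by ring: q4.
Qed.

Lemma power_series_eq0 a :
  (forall z : R[i], 0 < `|z| < 1 ->
     series (fun n => z ^+ n *: a n) @ \oo --> (0 : V)) ->
  forall n, a n = 0.
Proof.
move=> ha n; elim: n a ha => [|n IH] a ha; first exact: power_series_head_eq0.
apply: (IH (fun n => a n.+1)) => z z01.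
have a0 := power_series_head_eq0 ha.
have z0 : z != 0 by rewrite -normr_gt0; case/andP: z01.
have -> : series (fun n => z ^+ n *: a n.+1) =
   (fun N => z^-1 *: series (fun n => z ^+ n *: a n) N.+1).
  apply/funext; elim=> [|N IHN].
    by rewrite seriesSr !seriesEnat /= !big_geq // a0 scaler0 addr0 scaler0.
  rewrite seriesSr IHN [in RHS]seriesSr scalerDr scalerA exprS mulrA mulVf //.
  by rewrite mul1r.
rewrite -(scaler0 _ z^-1); apply: cvgZr.
by rewrite (cvg_shiftS (series (fun n => z ^+ n *: a n))); exact: ha.
Qed.

End PowerSeries.

End Sequences.

(** * Growth of the weights and convergence in the disc *)

Section WeightSequences.
Context {R : realType} (w : nat -> R) (hw : weight_sequence w).

Lemma weight_gt0 n : 0 < w n.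
Proof. by case: hw => -[]. Qed.

Lemma weight_inv_gt0 n : 0 < (w n)^-1.
Proof. by rewrite invr_gt0 weight_gt0. Qed.

Lemma weight_inv_ge1 n : 1 <= (w n)^-1.
Proof.
case: hw => -[_ ni w0 _] _ _ _; rewrite invf_ge1 ?weight_gt0 // -w0.
exact: ni.
Qed.

Lemma rho_ge0 n : 0 <= rho w n.
Proof.
case: n => [//|n] /=; rewrite subr_ge0 lef_pV2 ?posrE ?weight_gt0 //.
by case: hw => -[_ ni _ _] _ _ _; apply: ni.
Qed.

Lemma rhoS n : rho w n.+1 + (w n)^-1 = (w n.+1)^-1.
Proof. exact: subrK. Qed.

Lemma rho0 : rho w 0 = (w 0%N)^-1.
Proof. by case: hw => -[_ _ -> _] _ _ _; rewrite invr1. Qed.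

(** Here [rho_n <= 1/w_n <= 1/w_n^2], because [1/w_n >= 1]. It allows the single majorant
    [\sum_n t^n / w_n] to control both series in [char_fun]. *)
Lemma sqrt_rho_le n : Num.sqrt (rho w n) <= (w n)^-1.
Proof.
have rw : rho w n <= (w n)^-1.
  case: n => [|n]; first by rewrite rho0.
  by rewrite -rhoS lerDl ltW // weight_inv_gt0.
rewrite -(@ler_pXn2r _ 2) ?nnegrE ?sqrtr_ge0 ?(ltW (weight_inv_gt0 n)) //.
rewrite sqr_sqrtr ?rho_ge0 //; apply: le_trans rw _.
by rewrite expr2 ler_peMr ?weight_inv_ge1 // ltW // weight_inv_gt0.
Qed.

(** Pick [s] with [t < s < 1]. As the lower limit of [w_k^(1/k)] is [1], eventually [w_k >= s^k],
    and the terms are dominated by the geometric ones [(t / s)^k]. *)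
Lemma weight_inv_series_cvg (t : R) : 0 <= t -> t < 1 ->
  cvgn (series (fun n => (w n)^-1 * t ^+ n)).
Proof.
move=> t0 t1; case: hw => -[_ _ _ +] _ _ _.
set u := fun k : nat => _; rewrite limn_einf_lim => lu.
pose s : R := (1 + t) / 2.
have ts : t < s by rewrite /s; lra.
have s1 : s < 1 by rewrite /s; lra.
have s0 : 0 < s by exact: le_lt_trans t0 ts.
have [n hn] : exists n, (s%:E < einfs u n)%E.
  apply: contrapT => /forallNP h.
  have : (limn (einfs u) <= s%:E)%E.
    apply: lime_le; first exact: is_cvg_einfs.
    by apply: nearW => n; rewrite leNgt; apply/negP/h.
  by rewrite lu lee_fin leNgt s1.
(* Starting at [n.+1] keeps [k] positive, so that the k-th power undoes the exponent [k%:R^-1]. *)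
have hk k : (n.+1 <= k)%N -> (w k)^-1 * t ^+ k <= 1 * (t / s) ^+ k.
  move=> nk; rewrite mul1r exprMn mulrC exprVn; apply: ler_wpM2l; first exact: exprn_ge0.
  rewrite lef_pV2 ?posrE ?weight_gt0 ?exprn_gt0 //.
  have : (s%:E < u k)%E.
    apply: lt_le_trans hn _; apply: ereal_inf_lbound; exists k => //=.
    exact: ltnW.
  rewrite /u lte_fin => /ltW sk; apply: (@le_trans _ _ ((w k `^ k%:R^-1) ^+ k)).
    by apply: lerXn2r => //; rewrite nnegrE ?powR_ge0 // ltW.
  rewrite -powR_mulrn ?powR_ge0 // -powRrM mulVf ?powRr1 ?(ltW (weight_gt0 _)) //.
  by rewrite pnatr_eq0 -lt0n (leq_trans (ltn0Sn n) nk).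
rewrite -(is_cvg_series_restrict n.+1).
pose v k := if (k <= n)%N then 0 else (w k)^-1 * t ^+ k.
have -> : [sequence \sum_(n.+1 <= k < m) (w k)^-1 * t ^+ k]_m =
    [sequence \sum_(n.+1 <= k < m) v k]_m.
  apply/funext => m; apply: eq_big_nat => k /andP[nk _].
  by rewrite /v leqNgt nk.
rewrite is_cvg_series_restrict.
apply: (@series_le_cvg _ v (geometric 1 (t / s))).
- move=> k; rewrite /v; case: ifP => // _.
  by rewrite mulr_ge0 ?exprn_ge0 // ltW // weight_inv_gt0.
- by move=> k; rewrite /= mul1r exprn_ge0 // divr_ge0 // (ltW s0).
- move=> k; rewrite /v; case: leqP => [_|/hk//].
  by rewrite /= mul1r exprn_ge0 // divr_ge0 // (ltW s0).
apply: is_cvg_geometric_series.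
have ts0 : 0 <= t / s by apply: divr_ge0 => //; exact: ltW.
by rewrite (ger0_norm ts0) (ltr_pdivrMr _ _ s0) mul1r.
Qed.

End WeightSequences.

Lemma conj_real_complex (R : realType) (x : R) : Num.conj x%:C = x%:C.
Proof. exact: conjc_real. Qed.

(** * Characteristic triples *)

Lemma cvg_series_single (R : realType) (f : nat -> R[i]^o) m :
  (forall n, n != m -> f n = 0) -> series f @ \oo --> f m.
Proof.
move=> f0; apply: cvg_near_cst; exists m.+1 => // n /= mn.
by rewrite seriesEnat /= (bigD1_seq m) ?mem_index_iota ?iota_uniq //= big1 ?addr0.
Qed.

Lemma eq_l2_inner (R : realType) (H K : hilbertType R) (a b : nat -> H)
    (c d : nat -> K) :
  (forall n, inner (a n) (b n) = inner (c n) (d n)) ->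
  l2_inner a b = l2_inner c d.
Proof.
move=> h; rewrite /l2_inner.
by rewrite (_ : (fun n => _) = fun n => inner (c n) (d n) : R[i]^o) //; apply/funext.
Qed.

Section Defect.
Context {R : realType} (w : nat -> R) (H : hilbertType R) (T : H -> H).

(** This also covers the default value: if no square root exists, [defect] is the zero function,
    which is bounded and positive as well. *)
Lemma defect_bounded_positive :
  bounded_operator (defect w T) /\ positive_operator (defect w T).
Proof.
rewrite /defect /positive_sqrt; case: xgetP => [S _ [] //|_]; split.
  split; first by move=> a x y; rewrite scaler0 addr0.
  by exists 0 => x; rewrite normr0 mul0r.
by move=> x; rewrite inner0l.
Qed.

Definition defect_bounded := defect_bounded_positive.1.

Definition defect_linear := defect_bounded.1.

Lemma defect_sym x y : inner (defect w T x) y = inner x (defect w T y).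
Proof. exact: positive_operator_sym defect_linear defect_bounded_positive.2 x y. Qed.

Lemma defect_space_linear_subspace : linear_subspace (defect_space w T).
Proof.
by apply: closure_linear_subspace; exact: range_linear_subspace defect_linear.
Qed.

Lemma defect_in_space x : defect_space w T (defect w T x).
Proof. by apply: subset_closure; exists x. Qed.

End Defect.

(** Multiplication of a power series by [z], on coefficients. *)
Definition delay (V : nmodType) (f : nat -> V) (n : nat) : V :=
  if n is m.+1 then f m else 0.

Section Coefficients.
Context {R : realType} (w : nat -> R) (H : hilbertType R) (T : H -> H).

(* [obs_coef n] is the n-th Taylor coefficient of
   [z |-> defect (\sum_n (w n)^-1 z^n T^*^n)], [obs_adj n] is its adjoint, and
   [theta_coef n] is the n-th Taylor coefficient of [char_fun]. *)
Definition obs n x : H := defect w T (iter n (adjoint T) x).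

Definition obs_coef n x : H := (w n)^-1%:C *: obs n x.

Definition obs_adj n y : H := (w n)^-1%:C *: iter n T (defect w T y).

Definition theta_coef (E : hilbertType R) (B : E -> H) (D : E -> nat -> H) n e : H :=
  (Num.sqrt (rho w n))%:C *: D e n + delay (fun k => obs_coef k (B e)) n.

End Coefficients.

Section Triple.
Context {R : realType} (w : nat -> R) (hw : weight_sequence w).
Context (H E : hilbertType R) (T : H -> H) (hT : hypercontraction w T).
Context (B : E -> H) (D : E -> nat -> H) (hTBD : characteristic_triple w T B D).

Local Notation TA := (adjoint T).
Local Notation Delta := (defect w T).
Local Notation A := (defect_space w T).
Local Notation obsT := (obs w T).
Local Notation obs_coefT := (obs_coef w T).
Local Notation obs_adjT := (obs_adj w T).
Local Notation thetaT := (theta_coef w T B D).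

Let Tc : contraction T. Proof. by case: hT. Qed.
Let Tb : bounded_operator T. Proof. by case: Tc. Qed.
Let TAb : bounded_operator TA. Proof. exact: adjoint_bounded. Qed.
Let Bl : linear B. Proof. by case: hTBD => -[]. Qed.
Let Dl : linear D. Proof. by case: hTBD => _ []. Qed.

Let D0 n : D 0 n = 0.
Proof. by rewrite (linear_fun0 Dl). Qed.

Lemma triple_l2 e : l2 A (D e).
Proof. by case: hTBD => _ []. Qed.

Lemma obs_linear n : linear (obsT n).
Proof. exact: linear_comp (defect_linear w T) (linear_iter n TAb.1). Qed.

Lemma obs_bounded n : bounded_operator (obsT n).
Proof.
exact: bounded_operator_comp (defect_bounded w T) (bounded_operator_iter n TAb).
Qed.

Lemma obs_coef_linear n : linear (obs_coefT n).
Proof.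
by move=> a x y; rewrite /obs_coef obs_linear scalerDr !scalerA mulrC.
Qed.

Lemma obs_adjoint n x y : inner (obsT n x) y = inner x (iter n T (Delta y)).
Proof.
by rewrite defect_sym innerC -adjoint_iterE // -innerC.
Qed.

Lemma obs_coefE n x y : inner (obs_coefT n x) y = inner x (obs_adjT n y).
Proof. by rewrite innerZl innerZr conj_real_complex obs_adjoint. Qed.

Lemma delay_obs_coefE m x y :
  inner (delay (fun k => obs_coefT k x) m) y =
  inner x (delay (fun k => obs_adjT k y) m).
Proof. by case: m => [|m]; rewrite ?inner0l ?inner0r //= obs_coefE. Qed.

Lemma CopE x n : Cop w T x n = (Num.sqrt (rho w n))%:C *: obsT n x.
Proof. by []. Qed.

Lemma colligation_inner x e x' e' :
  inner (TA x + B e) (TA x' + B e') +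
  l2_inner (fun n => Cop w T x n + D e n) (fun n => Cop w T x' n + D e' n) =
  inner x x' + inner e e'.
Proof. by case: hTBD => _ _ [_ + _] => /(_ (x, e) (x', e')); exact. Qed.

Lemma colligation_surj h a : l2 A a ->
  exists x e, TA x + B e = h /\ forall n, Cop w T x n + D e n = a n.
Proof.
move=> la; case: hTBD => _ _ [_ _ im].
have : ([set: H] `*` l2 A) (h, a) by [].
rewrite -im => -[[x e] _ [hx ha]]; exists x, e; split=> // n.
by rewrite -ha.
Qed.

Lemma Cop0 n : Cop w T 0 n = 0.
Proof. by rewrite CopE (linear_fun0 (obs_linear n)) scaler0. Qed.

Lemma l2_single m c y : A y -> l2 A (fun n => if n == m then c *: y else 0).
Proof.
move=> Ay; have As := defect_space_linear_subspace w T; split.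
  by move=> n; case: ifP => _; [exact: linear_subspaceZ _ As Ay|exact: As.1].
apply: cvgP (@cvg_series_single _ _ m _) => n /negPf ->.
by rewrite normr0 expr0n.
Qed.

Lemma l2_inner_single a m c (y : H) :
  l2_inner a (fun n => if n == m then c *: y else 0) = Num.conj c * inner (a m) y.
Proof.
rewrite -innerZr; apply: (@cvg_lim R[i]^o); first exact: norm_hausdorff.
pose f n := inner (a n) (if n == m then c *: y else 0) : R[i]^o.
have : series f @ \oo --> f m.
  by apply: cvg_series_single => n /negPf nm; rewrite /f nm inner0r.
by rewrite {2}/f eqxx.
Qed.

Lemma defect_isometry x x' :
  inner x x' = inner (TA x) (TA x') + l2_inner (Cop w T x) (Cop w T x').
Proof.
have := colligation_inner x 0 x' 0; rewrite inner0r addr0 => <-.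
rewrite (linear_fun0 Bl) !addr0; congr (_ + l2_inner _ _);
  by apply/funext => n; rewrite D0 addr0.
Qed.

Lemma sqrt_rho_sq n :
  (Num.sqrt (rho w n))%:C * (Num.sqrt (rho w n))%:C = (rho w n)%:C :> R[i].
Proof. by rewrite -real_complexM -expr2 sqr_sqrtr ?rho_ge0. Qed.

(** This is where the choice of [rho] enters: applying [T] to the previous term leaves the weight
    [1/w_(m-1)], and [rho_m] is exactly what is missing to [1/w_m]. *)
Lemma obs_adj_rec m y :
  T (delay (fun k => obs_adjT k y) m) + (rho w m)%:C *: iter m T (Delta y) =
  obs_adjT m y.
Proof.
case: m => [|m]; rewrite [delay _ _]/=.
  by rewrite (linear_fun0 Tb.1) add0r (rho0 hw).
by rewrite (linear_funZ Tb.1) -scalerDl -real_complexD [_ + rho _ _]addrC rhoS.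
Qed.

Lemma obs_coef_rec n x :
  (rho w n)%:C *: obsT n x + delay (fun k => obs_coefT k (TA x)) n = obs_coefT n x.
Proof.
case: n => [|n]; rewrite [delay _ _]/=; first by rewrite addr0 (rho0 hw).
by rewrite /obs_coef /obs -iterSr -scalerDl -real_complexD rhoS.
Qed.

(* The colligation is onto, so [(delay obs_adjT m y, sqrt rho_m y at m)] has a
   preimage; its first component is forced to be [obs_adjT m y]. *)
Lemma theta_coef_adjoint m y : A y ->
  exists g, (forall e, inner (thetaT m e) y = inner e g) /\
    forall n, thetaT n g =
      (if n == m then (rho w m)%:C *: y else 0) +
      delay (fun k => obs_coefT k (delay (fun j => obs_adjT j y) m)) n -
      obs_coefT n (obs_adjT m y).
Proof.
move=> Ay; set p := delay _ m; set c := (Num.sqrt (rho w m))%:C : R[i].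
have [x [g [xg ag]]] := colligation_surj p (l2_single m c Ay).
have cc : Num.conj c = c by exact: conj_real_complex.
have agE : (fun n => Cop w T x n + D g n) = (fun n => if n == m then c *: y else 0).
  by apply/funext.
(* Isometry of the colligation, tested against the preimage [(x, g)]. Taking [f = 0] identifies [x];
   taking [z = 0] shows that [g] is the adjoint of [thetaT m] applied to [y]. *)
have col z f : inner (TA z + B f) p + c * inner (Cop w T z m + D f m) y =
    inner z x + inner f g.
  by rewrite -colligation_inner xg agE l2_inner_single cc.
have xE : x = obs_adjT m y.
  apply: inner_ext => z; have := col z 0.
  rewrite (linear_fun0 Bl) D0 !addr0 inner0l addr0 => <-.
  rewrite CopE innerZl mulrA sqrt_rho_sq adjointEl // obs_adjoint.
  by rewrite -obs_adj_rec innerDr innerZr conj_real_complex.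
exists g; split=> [e|n].
  have := col 0 e; rewrite (linear_fun0 TAb.1) Cop0 !add0r inner0l add0r => <-.
  by rewrite innerDl innerZl delay_obs_coefE addrC.
have Dg : D g n = (if n == m then c *: y else 0) - Cop w T x n.
  by rewrite -ag addrAC subrr add0r.
have Bg : B g = p - TA x by rewrite -xg addrAC subrr add0r.
(* The two terms in [x], one from [D g] and one from [B g], add up to [- obs_coefT n x] by
   [obs_coef_rec]. *)
rewrite /theta_coef Dg Bg scalerBr CopE scalerA sqrt_rho_sq.
rewrite -xE -(obs_coef_rec n x) opprD [RHS]addrACA.
have -> : delay (fun k => obs_coefT k (p - TA x)) n =
    delay (fun k => obs_coefT k p) n - delay (fun k => obs_coefT k (TA x)) n.
  case: n {Dg} => [|n] /=; first by rewrite subrr.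
  exact: linear_funB (obs_coef_linear n) _ _.
congr (_ - _ + _); case: eqP => [->|_]; last by rewrite scaler0.
by rewrite scalerA sqrt_rho_sq.
Qed.

Lemma theta_coef_in_space n e : A (thetaT n e).
Proof.
have As := defect_space_linear_subspace w T.
have Ao k x : A (obs_coefT k x) by apply: (linear_subspaceZ _ As); exact: defect_in_space.
apply: As.2; first by case: (triple_l2 e).
by case: n => [|n]; [exact: As.1|exact: Ao].
Qed.

Lemma theta_coef_series z e : `|z| < 1 ->
  series (fun n => z ^+ n *: thetaT n e) @ \oo --> char_fun w T B D z e.
Proof.
move=> z1; set t := complex.Re `|z|.
have zt : `|z| = t%:C by exact: ge0_complex.
have t0 : 0 <= t by exact: Re_ge0.
have t1 : t < 1 by rewrite -ltcR -zt.
have dom (K : R) (a : nat -> R) (v : nat -> H) :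
    (forall n, 0 <= a n <= (w n)^-1) -> (forall n, `|v n| <= K%:C) ->
    cvgn (series (fun n => ((a n)%:C * z ^+ n) *: v n)).
  move=> ha hv; apply: (@cvg_series_dominated _ _ _ (fun n => K * ((w n)^-1 * t ^+ n))).
    move=> n; rewrite normrZ normrM normrX zt norm_real_complex.
    have /andP[a0 aw] := ha n; rewrite (ger0_norm a0) -real_complexX -real_complexM.
    rewrite [K * _]mulrC [X in _ <= X]real_complexM; apply: ler_pM => //.
      by rewrite (lecR 0) mulr_ge0 // exprn_ge0.
    by rewrite lecR ler_wpM2r // exprn_ge0.
  by apply: is_cvg_seriesZ; exact: weight_inv_series_cvg.
(* The squares [|D e n|^2] are terms of a convergent series, hence bounded, and [d <= 1 + d^2]. *)
have [M hM] : exists M, forall n, `|D e n| <= M%:C.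
  have [_ /cvg_series_cvg_0/cvgP/cvg_norm_bounded[M hM]] := triple_l2 e.
  have M0 : 0 <= M by exact: le_trans (hM 0%N).
  exists (1 + complex.Re M) => n; rewrite real_complexD -ge0_complex //.
  apply: (@le_trans _ _ (1 + `|D e n| ^+ 2)); last first.
    by rewrite lerD2l; apply: le_trans (hM n); rewrite normrX normr_id.
  rewrite -subr_ge0; set d := `|D e n|.
  have -> : 1 + d ^+ 2 - d = (d - 2^-1) ^+ 2 + 3 / 4 by field.
  rewrite addr_ge0 //; apply: real_exprn_even_ge0 => //.
  by apply: realB; apply: ger0_real; rewrite ?normr_ge0 ?invr_ge0.
have c1 := dom M (fun n => Num.sqrt (rho w n)) (D e)
  (fun n => ltac:(by rewrite sqrtr_ge0 sqrt_rho_le)) hM.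
have c2 : cvgn (series (fun n => ((w n)^-1%:C * z ^+ n) *: iter n TA (B e))).
  apply: (dom (complex.Re `|B e|) (fun n => (w n)^-1)) => n.
    by rewrite lexx ltW // weight_inv_gt0.
  rewrite -normE; apply: contraction_iter => y; exact: adjoint_contraction.
pose F n := z ^+ n *: thetaT n e.
pose F1 n := ((Num.sqrt (rho w n))%:C * z ^+ n) *: D e n.
pose F2 n := ((w n)^-1%:C * z ^+ n) *: iter n TA (B e).
have Dell := defect_linear w T.
(* The factor [z] in [char_fun] delays the second series by one index, so its partial sums lag one
   term behind. *)
have FE n : series F n.+1 = series F1 n.+1 + z *: Delta (series F2 n).
  elim: n => [|n IH].
    rewrite !seriesSr !seriesEnat /= !big_geq // (linear_fun0 Dell) /F /F1.
    by rewrite /theta_coef scaler0 !addr0 !add0r expr0 scale1r mulr1.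
  rewrite (seriesSr F) IH (seriesSr F1 n.+1) (seriesSr F2 n).
  rewrite (linear_funD Dell) scalerDr [RHS]addrACA; congr (_ + _).
  rewrite /F /F1 /F2 /theta_coef /= (linear_funZ Dell) !scalerDr !scalerA.
  by rewrite mulrC /obs exprS; congr (_ + _ *: _); ring.
rewrite -(cvg_shiftS (series F)) (_ : [sequence _]_n =
  (fun n => series F1 n.+1 + z *: Delta (series F2 n))); last exact/funext.
apply: cvgD; first by rewrite (cvg_shiftS (series F1)); exact: c1.
by apply: cvgZr; apply: bounded_operator_cvg (defect_bounded w T) c2.
Qed.

Lemma char_fun_in_space z e : `|z| < 1 -> A (char_fun w T B D z e).
Proof.
move=> z1; have As := defect_space_linear_subspace w T.
apply: (closure_seq_closed _ (theta_coef_series (e := e) z1)) => n.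
apply: linear_subspace_series => // k.
by apply: (linear_subspaceZ _ As); exact: theta_coef_in_space.
Qed.

End Triple.

Section TwoTriples.
Context {R : realType} (w : nat -> R).
Context (H1 H2 E1 E2 : hilbertType R) (T1 : H1 -> H1) (T2 : H2 -> H2).
Context (hT1 : hypercontraction w T1) (pT1 : pure T1).
Context (hT2 : hypercontraction w T2) (pT2 : pure T2).
Context (B1 : E1 -> H1) (D1 : E1 -> nat -> H1).
Context (h1 : characteristic_triple w T1 B1 D1).
Context (B2 : E2 -> H2) (D2 : E2 -> nat -> H2).
Context (h2 : characteristic_triple w T2 B2 D2).

(* [|x|^2 - |T^* x|^2] is a series in the [|obs n x|^2]; iterate along [T^*^k x]
   and use purity. *)
Lemma inner_obs_determined (x x' : H1) (y y' : H2) :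
  (forall n, inner (obs w T1 n x) (obs w T1 n x') =
             inner (obs w T2 n y) (obs w T2 n y')) ->
  inner x x' = inner y y'.
Proof.
move=> h.
have step k : inner x x' - inner y y' =
    inner (iter k (adjoint T1) x) (iter k (adjoint T1) x') -
    inner (iter k (adjoint T2) y) (iter k (adjoint T2) y').
  elim: k => // k ->.
  rewrite (defect_isometry h1) (defect_isometry h2) -!iterS.
  set l1 := l2_inner _ _; set l2 := l2_inner _ _.
  suff -> : l1 = l2 by rewrite opprD addrACA subrr addr0.
  apply: eq_l2_inner => n.
  rewrite !CopE !innerZl !innerZr /obs -!iterD; congr (_ * (_ * _)).
  exact: (h (n + k)%N).
apply/eqP; rewrite -subr_eq0 -normr_eq0; apply/eqP.
apply: (@natmul_bounded_eq0 _ _ (`|x'| + `|y'|)) => // n.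
have [->|n0] := eqVneq n 0%N; first by rewrite mul0r addr_ge0.
have e0 : 0 < n%:R^-1 :> R[i] by rewrite invr_gt0 ltr0n lt0n.
rewrite -ler_pdivlMl ?ltr0n ?lt0n //.
have /cvgrPdist_lt/(_ _ e0)[N1 _ hN1] := pT1 x.
have /cvgrPdist_lt/(_ _ e0)[N2 _ hN2] := pT2 y.
rewrite (step (maxn N1 N2)); apply: le_trans (ler_normB _ _) _.
rewrite mulrDr; apply: lerD; apply: le_trans (inner_CauchySchwarz _ _) _;
  apply: ler_pM => //.
- have := hN1 (maxn N1 N2) (leq_maxl _ _); rewrite /= sub0r normrN; exact: ltW.
- apply: contraction_iter => z; apply: adjoint_contraction; exact: hT1.1.
- have := hN2 (maxn N1 N2) (leq_maxr _ _); rewrite /= sub0r normrN; exact: ltW.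
- apply: contraction_iter => z; apply: adjoint_contraction; exact: hT2.1.
Qed.

End TwoTriples.

(** * From coincidence to unitary equivalence *)

Section CoincidenceToEquivalence.
Context {R : realType} (w : nat -> R) (hw : weight_sequence w).
Context (H1 H2 E1 E2 : hilbertType R) (T1 : H1 -> H1) (T2 : H2 -> H2).
Context (hT1 : hypercontraction w T1) (pT1 : pure T1).
Context (hT2 : hypercontraction w T2) (pT2 : pure T2).
Context (B1 : E1 -> H1) (D1 : E1 -> nat -> H1).
Context (h1 : characteristic_triple w T1 B1 D1).
Context (B2 : E2 -> H2) (D2 : E2 -> nat -> H2).
Context (h2 : characteristic_triple w T2 B2 D2).
Context (tau : E2 -> E1) (taus : H1 -> H2).
Hypothesis tauu : unitary tau.
Hypothesis tausu :
  unitary_between (defect_space w T1) inner (defect_space w T2) inner taus.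
Hypothesis char_funE : forall z, `|z| < 1 -> forall e,
  char_fun w T2 B2 D2 z e = taus (char_fun w T1 B1 D1 z (tau e)).

Let A1s := defect_space_linear_subspace w T1.

Lemma theta_coef_coincide n e :
  theta_coef w T2 B2 D2 n e = taus (theta_coef w T1 B1 D1 n (tau e)).
Proof.
apply/eqP; rewrite -subr_eq0; apply/eqP.
apply: (@power_series_eq0 _ _ (fun n => theta_coef w T2 B2 D2 n e -
  taus (theta_coef w T1 B1 D1 n (tau e)))) => z /andP[_ z1].
have inA k : defect_space w T1 (z ^+ k *: theta_coef w T1 B1 D1 k (tau e)).
  by apply: (linear_subspaceZ _ A1s); exact: (theta_coef_in_space h1).
have c2 := theta_coef_series hw hT2 h2 (e := e) z1.
have c1 := unitary_between_cvg A1s tausu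
  (fun n => linear_subspace_series n A1s inA)
  (char_fun_in_space hw hT1 h1 (e := tau e) z1)
  (theta_coef_series hw hT1 h1 (e := tau e) z1).
rewrite -(subrr (char_fun w T2 B2 D2 z e)) {2}char_funE //.
have -> : series (fun n => z ^+ n *: (theta_coef w T2 B2 D2 n e -
      taus (theta_coef w T1 B1 D1 n (tau e)))) =
    series (fun n => z ^+ n *: theta_coef w T2 B2 D2 n e) -
    (fun k => taus (series (fun n => z ^+ n *: theta_coef w T1 B1 D1 n (tau e)) k)).
  apply/funext => k; transitivity (
    series (fun n => z ^+ n *: theta_coef w T2 B2 D2 n e) k -
    taus (series (fun n => z ^+ n *: theta_coef w T1 B1 D1 n (tau e)) k)) => //.
  rewrite (unitary_between_series A1s tausu) //.
  elim: k => [|k IH]; first by rewrite !seriesEnat /= !big_geq // subrr.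
  rewrite !seriesSr opprD addrACA IH; congr (_ + _).
  rewrite scalerBr (unitary_betweenZ A1s tausu) //; exact: (theta_coef_in_space h1).
exact: cvgB c2 c1.
Qed.

(** Solve the formula of [theta_coef_adjoint] for [v_n v_m^* y]. The term [theta_n theta_m^* y] is
    transported by coincidence, and the delayed term by the hypothesis. The latter is asked only for
    [n = k.+1] and [m = j.+1], since the delayed term is zero when [n] or [m] is. *)
Let taus_obs_coef_step n m y :
  (forall k, n = k.+1 -> forall j, m = j.+1 ->
    obs_coef w T2 k (obs_adj w T2 j (taus y)) =
    taus (obs_coef w T1 k (obs_adj w T1 j y))) ->
  defect_space w T1 y ->
  obs_coef w T2 n (obs_adj w T2 m (taus y)) =
  taus (obs_coef w T1 n (obs_adj w T1 m y)).
Proof.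
move=> IH Ay; have A2y := unitary_between_mem tausu Ay.
have [g1 [hg1 /(_ n) g1E]] := theta_coef_adjoint hw hT1 h1 m Ay.
have [g2 [hg2 /(_ n) g2E]] := theta_coef_adjoint hw hT2 h2 m A2y.
have coef_in k x : defect_space w T1 (obs_coef w T1 k x).
  by apply: (linear_subspaceZ _ A1s); exact: defect_in_space.
(* Both vectors have the same inner product with every [tau e]: [taus] is isometric on the values of
   [theta_coef], and [tau] is onto. *)
have tg : tau g2 = g1.
  apply: inner_ext => f; have [tau' [_ _ tauK]] := unitary_inverse tauu.
  rewrite -(tauK f) unitary_inner // -hg2 theta_coef_coincide.
  by rewrite (unitary_between_inner tausu) //; exact: (theta_coef_in_space h1).
have := theta_coef_coincide n g2; rewrite tg g1E g2E.
set d1 := if n == m then _ *: y else 0; set d2 := if n == m then _ else 0.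
set s2 := delay _ n; set s1 := delay _ n.
have d1A : defect_space w T1 d1.
  by rewrite /d1; case: ifP => _; [exact: (linear_subspaceZ _ A1s)|exact: A1s.1].
have s1A : defect_space w T1 s1.
  by rewrite /s1; case: (n) => [|k]; [exact: A1s.1|exact: coef_in].
have ds1A : defect_space w T1 (d1 + s1).
  by rewrite -[d1]scale1r; exact: A1s.2.
have -> : d2 = taus d1.
  rewrite /d2 /d1; case: ifP => _; last by rewrite (unitary_between0 A1s tausu).
  by rewrite (unitary_betweenZ A1s tausu).
have -> : s2 = taus s1.
  rewrite /s2 /s1; case: n IH {g1E g2E d1 d2 s1 s2 d1A s1A ds1A} => [|k] IH /=.
    by rewrite (unitary_between0 A1s tausu).
  case: m IH {hg1 hg2} => [|j] IH /=; last exact: IH.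
  rewrite !(linear_fun0 (obs_coef_linear _ _)) ?(unitary_between0 A1s tausu) //.
rewrite (unitary_betweenB tausu) // (unitary_betweenD tausu) //.
by move=> /addrI/oppr_inj.
Qed.

Lemma obs_coef_coincide n m y : defect_space w T1 y ->
  obs_coef w T2 n (obs_adj w T2 m (taus y)) =
  taus (obs_coef w T1 n (obs_adj w T1 m y)).
Proof.
move=> Ay; elim: n m => [|n IH] m; apply: taus_obs_coef_step => // k [<-] j _.
exact: IH.
Qed.

(** The graph of the unitary to be built. As a relation it is shown to be linear, isometric and
    single-valued before it is known to be everywhere defined. *)
Definition intertwined (x : H1) (y : H2) : Prop :=
  forall n, obs w T2 n y = taus (obs w T1 n x).

Let obs_in n x : defect_space w T1 (obs w T1 n x).
Proof. exact: defect_in_space. Qed.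

Lemma intertwined_inner x y x' y' :
  intertwined x y -> intertwined x' y' -> inner y y' = inner x x'.
Proof.
move=> xy xy'; apply/esym/(inner_obs_determined hT1 pT1 hT2 pT2 h1 h2) => n.
by rewrite xy xy' (unitary_between_inner tausu).
Qed.

Lemma intertwined_linear a x y x' y' :
  intertwined x y -> intertwined x' y' ->
  intertwined (a *: x + x') (a *: y + y').
Proof.
move=> xy xy' n; rewrite (obs_linear hT1) (obs_linear hT2) xy xy'.
by rewrite (unitary_between_lin tausu).
Qed.

Lemma intertwined_norm x y : intertwined x y -> `|y| = `|x|.
Proof.
move=> xy; apply/eqP; rewrite -(@eqrXn2 _ 2) // -!inner_normE.
by rewrite (intertwined_inner xy xy).
Qed.

Lemma intertwined_unique x y y' : intertwined x y -> intertwined x y' -> y = y'.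
Proof.
move=> xy xy'; have := intertwined_norm (intertwined_linear (-1) xy xy').
rewrite !scaleN1r addNr normr0 => /normr0_eq0/eqP.
by rewrite addrC subr_eq0 => /eqP.
Qed.

(** The domain [W] is a subspace, and it is closed because the relation is isometric: partners of a
    convergent sequence form a Cauchy sequence. By [obs_coef_coincide] it contains the vectors
    [T1^n Delta y] with [y] in the defect space, so a vector orthogonal to [W] has all its [obs]
    equal to zero and vanishes by purity. *)
Lemma intertwined_total x : exists y, intertwined x y.
Proof.
pose W := [set x | exists y, intertwined x y].
have Ws : linear_subspace W.
  split.
    exists 0 => n; rewrite (linear_fun0 (obs_linear hT2 n)).
    by rewrite (linear_fun0 (obs_linear hT1 n)) (unitary_between0 A1s tausu).
  move=> a x1 x2 [y1 h1'] [y2 h2']; exists (a *: y1 + y2).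
  exact: intertwined_linear.
have Wc : seq_closed W.
  move=> s l /choice[t st] sl.
  have /cvg_ex[y ty] : cvgn t.
    apply/cauchy_cvgP/cauchy_exP => e e0.
    have e2 : 0 < e / 2 by rewrite divr_gt0.
    have /cvgrPdist_lt/(_ _ e2)[N _ hN] := sl.
    exists (t N); exists N => // m /= Nm; rewrite -ball_normE /=.
    have := intertwined_norm (intertwined_linear (-1) (st m) (st N)).
    rewrite !scaleN1r ![- _ + _]addrC => ->.
    rewrite distrC -(subrKA l) [ltRHS]splitr; apply: le_lt_trans (ler_normD _ _) _.
    by apply: ltrD; first rewrite distrC; apply: hN => /=.
  exists y => n.
  have t1 : (fun k => taus (obs w T1 n (s k))) @ \oo --> obs w T2 n y.
    rewrite (_ : (fun k => _) = obs w T2 n \o t).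
      exact: bounded_operator_cvg (obs_bounded hT2 n) ty.
    by apply/funext => k; rewrite /= st.
  have t2 : (fun k => taus (obs w T1 n (s k))) @ \oo --> taus (obs w T1 n l).
    apply: (unitary_between_cvg A1s tausu) => //.
    exact: bounded_operator_cvg (obs_bounded hT1 n) sl.
  exact: (cvg_unique (@norm_hausdorff _ H2) t1 t2).
have [v [y vy] xv] := orthogonal_projection Ws Wc x.
suff -> : x = v by exists y.
apply/eqP; rewrite -subr_eq0; apply/eqP; apply: inner_eq0.
rewrite -(@inner0l _ H1 0).
(* The comparison lemma with both models equal, against the vector [0]: observations separate
   points. *)
apply: (inner_obs_determined hT1 pT1 hT1 pT1 h1 h1) => n.
set z := x - v; rewrite (linear_fun0 (obs_linear hT1 n)) inner0l.
rewrite (obs_adjoint hT1) innerC -[RHS]conjC0; congr (Num.conj _).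
apply: xv; exists (iter n T2 (defect w T2 (taus (obs w T1 n z)))) => k.
have := obs_coef_coincide k n (@obs_in n z).
have wC j : (w j)^-1%:C != 0 :> R[i].
  by rewrite gt_eqF // (ltcR 0) weight_inv_gt0.
rewrite /obs_adj !(linear_funZ (obs_coef_linear _ k)) // /obs_coef.
rewrite !(unitary_betweenZ A1s tausu) //; last exact: (linear_subspaceZ _ A1s).
by move/(scalerI (wC n))/(scalerI (wC k)).
Qed.

End CoincidenceToEquivalence.

Lemma coincide_unitarily_equivalent (R : realType) (w : nat -> R)
    (hw : weight_sequence w) (H1 H2 E1 E2 : hilbertType R)
    (T1 : H1 -> H1) (T2 : H2 -> H2)
    (hT1 : hypercontraction w T1) (pT1 : pure T1)
    (hT2 : hypercontraction w T2) (pT2 : pure T2)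
    (B1 : E1 -> H1) (D1 : E1 -> nat -> H1)
    (h1 : characteristic_triple w T1 B1 D1)
    (B2 : E2 -> H2) (D2 : E2 -> nat -> H2)
    (h2 : characteristic_triple w T2 B2 D2) :
  coincide (defect_space w T1) (char_fun w T1 B1 D1)
           (defect_space w T2) (char_fun w T2 B2 D2) ->
  unitarily_equivalent T1 T2.
Proof.
move=> [tau [taus [tauu tausu hth]]].
have A1s := defect_space_linear_subspace w T1.
have [tau' [tau'u _ tauK]] := unitary_inverse tauu.
have [taus' [taus'u tausK tausK']] := unitary_between_inverse A1s tausu.
(* The coincidence read backwards; totality for the inverse pair will make [u] surjective. *)
have hth' z (z1 : `|z| < 1) e :
    char_fun w T1 B1 D1 z e = taus' (char_fun w T2 B2 D2 z (tau' e)).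
  by rewrite hth // tauK tausK //; exact: (char_fun_in_space hw hT1 h1).
have /choice[u hu] := intertwined_total hw hT1 pT1 hT2 pT2 h1 h2 tauu tausu hth.
have u_unique x y : intertwined w T1 T2 taus x y -> y = u x.
  move=> xy; exact: (intertwined_unique hT1 pT1 hT2 pT2 h1 h2 tausu xy (hu x)).
have ul : linear u.
  move=> a x y; apply/esym/u_unique.
  exact: (intertwined_linear hT1 hT2 tausu a (hu x) (hu y)).
have ui x y : inner (u x) (u y) = inner x y.
  exact: (intertwined_inner hT1 pT1 hT2 pT2 h1 h2 tausu (hu x) (hu y)).
have us y : exists x, u x = y.
  have [x hx] := intertwined_total hw hT2 pT2 hT1 pT1 h2 h1 tau'u taus'u hth' y.
  exists x; apply/esym/u_unique => n; rewrite hx tausK' //; exact: defect_in_space.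
(* Applying the adjoint shifts observations by one index, so the relation is preserved. *)
have uT x : u (adjoint T1 x) = adjoint T2 (u x).
  by apply/esym/u_unique => n; rewrite /obs -!iterSr; exact: (hu x n.+1).
exists u.
  split=> [a x y _ _|x y _ _|]; [exact: ul|exact: ui|].
  by apply/seteqP; split=> // y _; have [x <-] := us y; exists x.
move=> x; apply: inner_ext => z; have [y <-] := us z.
by rewrite ui -(adjointEl hT1.1.1) -ui uT (adjointEl hT2.1.1).
Qed.

(** * From unitary equivalence to coincidence *)

Section Limits.
Context {R : realType} (H K : hilbertType R) (u : H -> K) (v : K -> H).
Hypotheses (ub : bounded_operator u) (vb : bounded_operator v) (vK : cancel u v).

Lemma cvg_bounded_bijective T (F : set_system T) {FF : Filter F} (g : T -> H) :
  cvg (u \o g @ F) <-> cvg (g @ F).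
Proof.
split=> [/cvg_ex[l gl]|/cvg_ex[l gl]]; apply/cvg_ex; last first.
  by exists (u l); exact: bounded_operator_cvg.
exists (v l); have : v \o (u \o g) @ F --> v l by exact: bounded_operator_cvg.
by rewrite (_ : v \o (u \o g) = g) //; apply/funext => t /=; rewrite vK.
Qed.

(* A divergent [lim] is the unspecified element [point]. *)
Lemma lim_bounded_bijective T (F : set_system T) {FF : ProperFilter F} (g : T -> H) :
  (~ cvg (g @ F) -> (point : H) = 0 /\ (point : K) = 0) ->
  lim (u \o g @ F) = u (lim (g @ F)).
Proof.
move=> h; have [cg|ncg] := pselect (cvg (g @ F)).
  apply: cvg_lim; first exact: norm_hausdorff.
  exact: bounded_operator_cvg.
have ncu : ~ cvg (u \o g @ F) by move/cvg_bounded_bijective.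
have [pH pK] := h ncg.
by rewrite (dvgP ncg) (dvgP ncu) pH pK (linear_fun0 ub.1).
Qed.

End Limits.

(** * The default value of a divergent defect series *)

Section DefectPoint.
Context {R : realType} (w : nat -> R) (H : hilbertType R) (T : H -> H).
Hypothesis hT : hypercontraction w T.

Definition defect_series (r : R) (x : H) : nat -> H :=
  series (fun n => (ccoef w n * r%:C ^+ n) *: iter n T (iter n (adjoint T) x)).

Lemma defect_series_linear r n : linear (defect_series r ^~ n).
Proof.
have Tl := hT.1.1.1; have TAl := (adjoint_bounded hT.1).1.
move=> a x y; rewrite /defect_series; elim: n => [|n IH].
  by rewrite !seriesEnat /= !big_geq // scaler0 addr0.
rewrite !seriesSr IH scalerDr addrACA; congr (_ + _).
by rewrite (linear_iter n TAl) (linear_iter n Tl) scalerDr !scalerA mulrC.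
Qed.

(* By positivity [point] is orthogonal to every vector of divergence; these
   vectors form the complement of a proper subspace, hence span [H]. *)
Lemma defect_at_divergent_point r x : 0 < r < 1 ->
  ~ cvgn (defect_series r x) -> (point : H) = 0.
Proof.
move=> r01 ncx.
have cvgl a y z : cvgn (defect_series r y) -> cvgn (defect_series r z) ->
    cvgn (defect_series r (a *: y + z)).
  move=> /cvg_ex[k yk] /cvg_ex[l zl]; apply/cvg_ex; exists (a *: k + l).
  rewrite (_ : defect_series r _ =
    fun n => a *: defect_series r y n + defect_series r z n).
    by apply: cvgD => //; apply: cvgZr.
  by apply/funext => n; exact: defect_series_linear.
have pt0 y : ~ cvgn (defect_series r y) -> inner (point : H) y = 0.
  move=> ncy.
  (* The series diverges at every nonzero multiple of [y] too, so [defect_at] takes the value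
     [point] there. The cases [a = 1] and [a = -1] then force the inner product to vanish. *)
  have pos a : a != 0 -> 0 <= Num.conj a * inner (point : H) y.
    move=> a0; rewrite -innerZr.
    have nca : ~ cvgn (defect_series r (a *: y)).
      move=> ca; apply: ncy.
      have c0 : cvgn (defect_series r 0).
        rewrite (_ : defect_series r 0 = fun=> 0); first exact: is_cvg_cst.
        by apply/funext => n; rewrite (linear_fun0 (defect_series_linear r n)).
      have := cvgl a^-1 _ _ ca c0.
      by rewrite addr0 scalerA mulVf // scale1r.
    by have := hT.2 r r01 (a *: y); rewrite /defect_at -/(defect_series r _) (dvgP nca).
  set p := inner _ _.
  apply/eqP; rewrite eq_le; apply/andP; split.
    have := pos (-1); rewrite oppr_eq0 oner_eq0 rmorphN rmorph1 mulN1r oppr_ge0.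
    exact.
  by have := pos 1 (oner_neq0 _); rewrite rmorph1 mul1r.
apply: inner_eq0; set q := (point : H).
(* If the series converges at [q = point], then [q] is the difference of [x + q] and [x], at both of
   which it diverges. *)
have [cq|/pt0//] := pselect (cvgn (defect_series r q)).
have ncxq : ~ cvgn (defect_series r (x + q)).
  move=> c; apply: ncx; have := cvgl (-1) _ _ cq c.
  by rewrite scaleN1r addrC addrK.
by have := pt0 _ ncxq; rewrite innerDr (pt0 _ ncx) add0r.
Qed.

End DefectPoint.

Section Intertwining.
Context {R : realType} (w : nat -> R) (H1 H2 : hilbertType R).
Context (T1 : H1 -> H1) (T2 : H2 -> H2).
Hypotheses (hT1 : hypercontraction w T1) (hT2 : hypercontraction w T2).
Context (u : H1 -> H2) (v : H2 -> H1).
Hypotheses (ub : bounded_operator u) (vb : bounded_operator v).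
Hypotheses (uK : cancel u v).
Hypothesis uT : forall x, u (T1 x) = T2 (u x).
Hypothesis uTA : forall x, u (adjoint T1 x) = adjoint T2 (u x).

Lemma iter_intertwine n x :
  u (iter n (adjoint T1) x) = iter n (adjoint T2) (u x).
Proof. by elim: n => //= n <-. Qed.

Lemma defect_series_intertwine r x :
  defect_series w T2 r (u x) = u \o defect_series w T1 r x.
Proof.
apply/funext => n; rewrite /defect_series /=; elim: n => [|n IH].
  by rewrite !seriesEnat /= !big_geq // (linear_fun0 ub.1).
rewrite !seriesSr (linear_funD ub.1) -IH; congr (_ + _).
rewrite (linear_funZ ub.1) -iter_intertwine; congr (_ *: _).
by elim: n {IH} (iter n _ x) => //= n IH y; rewrite uT IH.
Qed.

Lemma defect_at_intertwine r x : 0 < r < 1 ->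
  defect_at w T2 r (u x) = u (defect_at w T1 r x).
Proof.
move=> r01; rewrite /defect_at -/(defect_series w T2 r (u x)) defect_series_intertwine.
apply: (lim_bounded_bijective ub vb uK) => ncg; split.
  exact: (defect_at_divergent_point hT1 r01 ncg).
apply: (@defect_at_divergent_point _ _ _ _ hT2 r (u x) r01).
by rewrite defect_series_intertwine => /(cvg_bounded_bijective ub vb uK).
Qed.

(** The pointwise intertwining holds for [0 < r < 1], which is eventually true at [1] from the left.
    Equality of the image filters transfers the limit together with its default. The map [u] is
    merely bounded with a bounded left inverse, so that multiplication by [2] is an instance. *)
Lemma defect_at_intertwine_left x :
  defect_at w T2 r (u x) @[r --> (1 : R)^'-] =
  u \o (defect_at w T1 ^~ x) @ (1 : R)^'-.
Proof.
have near01 : \forall r \near (1 : R)^'-, 0 < r < 1.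
  near=> r; apply/andP; split; near: r; [exact: nbhs_left_gt|exact: nbhs_left_lt].
apply/seteqP; split=> A /= hA; apply: filterS2 near01 hA => r r01.
- by rewrite /= defect_at_intertwine.
- by rewrite /= defect_at_intertwine.
Unshelve. all: by end_near.
Qed.

End Intertwining.

(** Divergence at [x] implies divergence at [2 x], so the linear operator [S \o S] takes the value
    [point] at both, and [point = 2 point]. *)
Lemma defect_one_divergent_point (R : realType) (w : nat -> R)
    (H : hilbertType R) (T S : H -> H) x :
  hypercontraction w T -> linear S -> S \o S = defect_one w T ->
  ~ cvg (defect_at w T ^~ x @ (1 : R)^'-) -> (point : H) = 0.
Proof.
move=> hT Sl SS ncx; have Tl := hT.1.1.1; have TAl := (adjoint_bounded hT.1).1.
have scaleb (a : R[i]) : bounded_operator ( *:%R a : H -> H).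
  split; first by move=> b y z; rewrite scalerDr !scalerA mulrC.
  by exists `|a| => y; rewrite normrZ.
have K2 : cancel ( *:%R 2 : H -> H) ( *:%R 2^-1).
  by move=> y; rewrite scalerA mulVf // scale1r.
have E2 := defect_at_intertwine_left hT hT (scaleb 2) (scaleb 2^-1) K2
  (fun y => esym (linear_funZ Tl 2 y)) (fun y => esym (linear_funZ TAl 2 y)) x.
have D1 : S (S x) = point.
  by rewrite -[S (S x)]/((S \o S) x) SS /defect_one (dvgP ncx).
have D2 : S (S (2 *: x)) = point.
  rewrite -[S (S _)]/((S \o S) (2 *: x)) SS /defect_one E2; apply: dvgP.
  by move/(cvg_bounded_bijective (scaleb 2) (scaleb 2^-1) K2).
move: D2; rewrite !(linear_funZ Sl) D1 scaler_nat mulr2n.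
by move=> /(canRL (addrK _)); rewrite subrr.
Qed.

(** * Defect operators under unitary equivalence *)

Section Unitary.
Context {R : realType} (w : nat -> R).
Context (H1 H2 : hilbertType R) (T1 : H1 -> H1) (T2 : H2 -> H2).
Context (hT1 : hypercontraction w T1) (hT2 : hypercontraction w T2).
Context (u : H1 -> H2) (v : H2 -> H1).
Hypotheses (uu : unitary u) (vu : unitary v) (uK : cancel u v) (vK : cancel v u).
Hypothesis uT : forall x, u (T1 x) = T2 (u x).

Let ub := unitary_bounded uu.
Let vb := unitary_bounded vu.

Lemma unitary_intertwine_adjoint x : u (adjoint T1 x) = adjoint T2 (u x).
Proof.
apply: inner_ext => z; rewrite -(vK z) unitary_inner // -(adjointE hT1.1.1).
by rewrite -(adjointE hT2.1.1) -uT unitary_inner.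
Qed.

Lemma defect_one_intertwine S1 S2 :
  linear S1 -> S1 \o S1 = defect_one w T1 ->
  linear S2 -> S2 \o S2 = defect_one w T2 ->
  forall x, defect_one w T2 (u x) = u (defect_one w T1 x).
Proof.
move=> S1l SS1 S2l SS2 x.
have E := defect_at_intertwine_left hT1 hT2 ub vb uK uT unitary_intertwine_adjoint x.
rewrite /defect_one E; apply: (lim_bounded_bijective ub vb uK) => ncg; split.
  exact: defect_one_divergent_point hT1 S1l SS1 ncg.
apply: (defect_one_divergent_point hT2 S2l SS2 (x := u x)).
by rewrite E => /(cvg_bounded_bijective ub vb uK).
Qed.

Lemma positive_sqrt_intertwine S1 S2 :
  bounded_operator S1 -> positive_operator S1 -> S1 \o S1 = defect_one w T1 ->
  bounded_operator S2 -> positive_operator S2 -> S2 \o S2 = defect_one w T2 ->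
  forall x, S2 (u x) = u (S1 x).
Proof.
move=> S1b S10 SS1 S2b S20 SS2 x.
suff -> : S2 = u \o S1 \o v by rewrite /= uK.
apply: positive_sqrt_unique => //.
- by apply: bounded_operator_comp => //; exact: bounded_operator_comp.
- by move=> y; rewrite /= -[in X in inner _ X](vK y) unitary_inner //; exact: S10.
- apply/funext => y; rewrite SS2 /= uK -{1}(vK y).
  rewrite (defect_one_intertwine S1b.1 SS1 S2b.1 SS2).
  by rewrite -SS1.
Qed.

End Unitary.

(* Without a square root of [defect_one] the junk value of [defect] is [0]. *)
Lemma no_sqrt_trivial (R : realType) (w : nat -> R) (H E : hilbertType R)
    (T : H -> H) (hT : hypercontraction w T) (pT : pure T)
    (B : E -> H) (D : E -> nat -> H) (h : characteristic_triple w T B D) :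
  (~ exists S, [/\ bounded_operator S, positive_operator S &
                   S \o S = defect_one w T]) ->
  forall x : H, x = 0.
Proof.
move=> nS; have D0 y : defect w T y = 0.
  rewrite /defect /positive_sqrt; case: xgetP => // S _ hS.
  by case: nS; exists S.
move=> x; apply: inner_eq0; rewrite -(@inner0l _ H 0).
by apply: (inner_obs_determined hT pT hT pT h h) => n; rewrite /obs !D0.
Qed.

(** If one of the two square roots does not exist, its space is zero by [no_sqrt_trivial], hence so
    is the other through [u], and both sides vanish. Otherwise both [defect] operators are genuine
    roots. *)
Lemma defect_intertwine (R : realType) (w : nat -> R)
    (H1 H2 E1 E2 : hilbertType R) (T1 : H1 -> H1) (T2 : H2 -> H2)
    (hT1 : hypercontraction w T1) (pT1 : pure T1)
    (hT2 : hypercontraction w T2) (pT2 : pure T2)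
    (B1 : E1 -> H1) (D1 : E1 -> nat -> H1)
    (h1 : characteristic_triple w T1 B1 D1)
    (B2 : E2 -> H2) (D2 : E2 -> nat -> H2)
    (h2 : characteristic_triple w T2 B2 D2)
    (u : H1 -> H2) (uu : unitary u) (uT : forall x, u (T1 x) = T2 (u x)) x :
  defect w T2 (u x) = u (defect w T1 x).
Proof.
have [v [vu uK vK]] := unitary_inverse uu.
have [h|/(no_sqrt_trivial hT1 pT1 h1) H0] := pselect (exists S,
    [/\ bounded_operator S, positive_operator S & S \o S = defect_one w T1]); last first.
  rewrite -[LHS]vK (H0 (v _)) (H0 (defect _ _ _)) //.
have [h'|/(no_sqrt_trivial hT2 pT2 h2) H0] := pselect (exists S,
    [/\ bounded_operator S, positive_operator S & S \o S = defect_one w T2]); last first.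
  by rewrite (H0 (defect _ _ _)) (H0 (u _)).
have sqrtE (H : hilbertType R) (T : H -> H) : (exists S,
    [/\ bounded_operator S, positive_operator S & S \o S = defect_one w T]) ->
    [/\ bounded_operator (defect w T), positive_operator (defect w T) &
      defect w T \o defect w T = defect_one w T].
  by move=> [S hS]; rewrite /defect /positive_sqrt; case: xgetP => [//|/(_ S)].
have [b1 p1 s1] := sqrtE _ _ h; have [b2 p2 s2] := sqrtE _ _ h'.
exact: (positive_sqrt_intertwine hT1 hT2 uu vu uK vK uT b1 p1 s1 b2 p2 s2).
Qed.

Lemma unitary_defect_space (R : realType) (w : nat -> R) (H1 H2 : hilbertType R)
    (T1 : H1 -> H1) (T2 : H2 -> H2) (u : H1 -> H2) (uu : unitary u) :
  (forall x, defect w T2 (u x) = u (defect w T1 x)) ->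
  forall x, defect_space w T1 x -> defect_space w T2 (u x).
Proof.
move=> uD x /closure_normP hx; apply/closure_normP => e /hx[_ [y _ <-] xy].
exists (u (defect w T1 y)); first by rewrite -uD; exists (u y).
by rewrite -(linear_funB (unitary_linear uu)) unitary_norm.
Qed.

Section EquivalenceToCoincidence.
Context {R : realType} (w : nat -> R).
Context (H1 H2 E1 E2 : hilbertType R) (T1 : H1 -> H1) (T2 : H2 -> H2).
Context (hT1 : hypercontraction w T1) (pT1 : pure T1).
Context (hT2 : hypercontraction w T2) (pT2 : pure T2).
Context (B1 : E1 -> H1) (D1 : E1 -> nat -> H1).
Context (h1 : characteristic_triple w T1 B1 D1).
Context (B2 : E2 -> H2) (D2 : E2 -> nat -> H2).
Context (h2 : characteristic_triple w T2 B2 D2).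
Context (u : H1 -> H2) (v : H2 -> H1).
Hypotheses (uu : unitary u) (vu : unitary v) (uK : cancel u v) (vK : cancel v u).
Hypothesis uT : forall x, u (T1 x) = T2 (u x).

Let uD x : defect w T2 (u x) = u (defect w T1 x).
Proof. exact: (defect_intertwine hT1 pT1 hT2 pT2 h1 h2). Qed.

Let uTA x : u (adjoint T1 x) = adjoint T2 (u x).
Proof. exact: (unitary_intertwine_adjoint hT1 hT2 uu vK uT). Qed.

Lemma obs_intertwine n x : obs w T2 n (u x) = u (obs w T1 n x).
Proof. by rewrite /obs -uD (iter_intertwine uTA). Qed.

(* [(u^-1 B2 e, u^-1 D2 e)] is in the range of the first colligation; its
   preimage is orthogonal to [H1], hence lies in [E1]. *)
Lemma triple_transfer e :
  exists e', u (B1 e') = B2 e /\ forall n, u (D1 e' n) = D2 e n.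
Proof.
have B1l : linear B1 by case: h1 => -[].
have B2l : linear B2 by case: h2 => -[].
have D1l : linear D1 by case: h1 => _ [].
have D2l : linear D2 by case: h2 => _ [].
have vD y : defect w T1 (v y) = v (defect w T2 y).
  by rewrite -[LHS]uK -uD vK.
have l2v : l2 (defect_space w T1) (fun n => v (D2 e n)).
  have [AD cD] := triple_l2 h2 e; split.
    by move=> n; apply: (unitary_defect_space vu vD).
  rewrite (_ : (fun n => _) = (fun n => `|D2 e n| ^+ 2 : R[i]^o)) //.
  by apply/funext => n; rewrite unitary_norm.
have [x [e' [xB xD]]] := colligation_surj h1 (v (B2 e)) l2v.
have x0 : x = 0.
  (* The first colligation turns [<x, x>] into the inner product of the images of [(x, e')] and
     [(x, 0)]. Under [u] these correspond to the images of [(0, e)] and [(u x, 0)] under the second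
     one, which are orthogonal. *)
  apply: inner_eq0.
  have := colligation_inner h1 x e' x 0; rewrite inner0r addr0 => <-.
  have := colligation_inner h2 0 e (u x) 0; rewrite inner0r inner0l addr0 => <-.
  rewrite xB !(linear_fun0 B1l) !(linear_fun0 B2l) !addr0.
  rewrite (linear_fun0 (adjoint_bounded hT2.1).1) add0r.
  congr (_ + _).
    by rewrite -uTA -[in RHS](vK (B2 e)) unitary_inner.
  apply: eq_l2_inner => n; rewrite xD (linear_fun0 D1l) (linear_fun0 D2l) !addr0.
  rewrite (Cop0 hT2) add0r !CopE obs_intertwine -(linear_funZ (unitary_linear uu)).
  by rewrite -[in RHS](vK (D2 e n)) unitary_inner.
exists e'; split=> [|n].
  by rewrite -[RHS]vK -xB x0 (linear_fun0 (adjoint_bounded hT1.1).1) add0r.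
by rewrite -[RHS]vK -xD x0 (Cop0 hT1) add0r.
Qed.

End EquivalenceToCoincidence.

Lemma triple_inner (R : realType) (w : nat -> R) (H E : hilbertType R)
    (T : H -> H) (hT : hypercontraction w T)
    (B : E -> H) (D : E -> nat -> H) (h : characteristic_triple w T B D) e f :
  inner (B e) (B f) + l2_inner (D e) (D f) = inner e f.
Proof.
have := colligation_inner h 0 e 0 f; rewrite inner0l add0r => <-.
rewrite (linear_fun0 (adjoint_bounded hT.1).1) !add0r; congr (_ + _).
by apply: eq_l2_inner => n; rewrite (Cop0 hT) !add0r.
Qed.

Lemma unitarily_equivalent_coincide (R : realType) (w : nat -> R)
    (hw : weight_sequence w) (H1 H2 E1 E2 : hilbertType R)
    (T1 : H1 -> H1) (T2 : H2 -> H2)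
    (hT1 : hypercontraction w T1) (pT1 : pure T1)
    (hT2 : hypercontraction w T2) (pT2 : pure T2)
    (B1 : E1 -> H1) (D1 : E1 -> nat -> H1)
    (h1 : characteristic_triple w T1 B1 D1)
    (B2 : E2 -> H2) (D2 : E2 -> nat -> H2)
    (h2 : characteristic_triple w T2 B2 D2) :
  unitarily_equivalent T1 T2 ->
  coincide (defect_space w T1) (char_fun w T1 B1 D1)
           (defect_space w T2) (char_fun w T2 B2 D2).
Proof.
move=> [u uu uT]; have [v [vu uK vK]] := unitary_inverse uu.
have vT y : v (T2 y) = T1 (v y) by rewrite -[RHS]uK uT vK.
have ul := unitary_linear uu.
have uD := defect_intertwine hT1 pT1 hT2 pT2 h1 h2 uu uT.
have vD := defect_intertwine hT2 pT2 hT1 pT1 h2 h1 vu vT.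
have /choice[tau htau] := triple_transfer hT1 pT1 hT2 pT2 h1 h2 uu vu uK vK uT.
have tauI e f : inner (tau e) (tau f) = inner e f.
  have [[Be De] [Bf Df]] := (htau e, htau f).
  rewrite -(triple_inner hT1 h1) -(triple_inner hT2 h2) -Be -Bf (unitary_inner _ _ uu).
  congr (_ + _); apply: eq_l2_inner => n.
  by rewrite -De -Df (unitary_inner _ _ uu).
(* The column formed by [B1] and [D1] is isometric, hence injective, so these equations determine
   [e']. Linearity and surjectivity of [tau] both follow from this. *)
have tauP e e' : B2 e = u (B1 e') -> (forall n, D2 e n = u (D1 e' n)) -> tau e = e'.
  move=> Be De; have [Be' De'] := htau e.
  have B1l : linear B1 by case: h1 => -[].
  have D1l : linear D1 by case: h1 => _ [].
  have ui : injective u := can_inj uK.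
  apply/eqP; rewrite -subr_eq0; apply/eqP/inner_eq0.
  rewrite -(triple_inner hT1 h1) (linear_funB B1l).
  have -> : B1 (tau e) = B1 e' by apply: ui; rewrite Be'.
  have -> : D1 (tau e - e') = D1 0.
    apply/funext => n; rewrite (linear_funB D1l) (linear_fun0 D1l).
    have -> : D1 (tau e) = D1 e' by apply/funext => k; apply: ui; rewrite De'.
    by rewrite subrr.
  by rewrite subrr -(linear_fun0 B1l) (triple_inner hT1 h1) inner0l.
have tauu : unitary tau.
  split=> [a e f _ _|e f _ _|]; [|exact: tauI|].
    have [[Be De] [Bf Df]] := (htau e, htau f).
    have B1l : linear B1 by case: h1 => -[].
    have B2l : linear B2 by case: h2 => -[].
    have D1l : linear D1 by case: h1 => _ [].
    have D2l : linear D2 by case: h2 => _ [].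
    apply: tauP => [|n]; first by rewrite B2l B1l ul Be Bf.
    by rewrite D2l D1l [RHS]ul De Df.
  apply/seteqP; split=> // e' _.
  have [e [Be De]] := triple_transfer hT2 pT2 hT1 pT1 h2 h1 vu uu vK uK vT e'.
  by exists e => //; apply: tauP => [|n]; rewrite -?Be -?De vK.
exists tau, u; split=> //.
  split=> [a x y _ _|x y _ _|]; [exact: ul|exact: unitary_inner|].
  apply/seteqP; split=> [_ [x Ax <-]|y Ay].
    exact: (unitary_defect_space uu uD).
  by exists (v y) => //; exact: (unitary_defect_space vu vD).
move=> z z1 e; have [Be De] := htau e.
have thE n : theta_coef w T2 B2 D2 n e = u (theta_coef w T1 B1 D1 n (tau e)).
  rewrite /theta_coef (linear_funD ul) (linear_funZ ul) De; congr (_ + _).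
  case: n => [|n] /=; first by rewrite (linear_fun0 ul).
  rewrite /obs_coef (linear_funZ ul) -Be.
  by rewrite (obs_intertwine hT1 pT1 hT2 pT2 h1 h2 uu vK uT).
have c2 := theta_coef_series hw hT2 h2 (e := e) z1.
have c1 : u \o series (fun n => z ^+ n *: theta_coef w T1 B1 D1 n (tau e)) @ \oo
    --> u (char_fun w T1 B1 D1 z (tau e)).
  apply: bounded_operator_cvg; first exact: unitary_bounded.
  exact: (theta_coef_series hw hT1 h1).
apply: (cvg_unique (@norm_hausdorff _ H2) c2).
rewrite (_ : series _ = u \o series (fun n => z ^+ n *: theta_coef w T1 B1 D1 n (tau e))) //.
apply/funext; elim=> [|n IH].
  by rewrite /= !seriesEnat /= !big_geq // (linear_fun0 ul).
by rewrite /= !seriesSr IH (linear_funD ul) (linear_funZ ul) thE.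
Qed.

Theorem theorem2p10 (R : realType) (w : nat -> R) (hw : weight_sequence w)
    (H1 H2 E1 E2 : hilbertType R)
    (T1 : H1 -> H1) (T2 : H2 -> H2)
    (hT1 : hypercontraction w T1) (pT1 : pure T1)
    (hT2 : hypercontraction w T2) (pT2 : pure T2)
    (B1 : E1 -> H1) (D1 : E1 -> nat -> H1)
    (h1 : characteristic_triple w T1 B1 D1)
    (B2 : E2 -> H2) (D2 : E2 -> nat -> H2)
    (h2 : characteristic_triple w T2 B2 D2) :
  unitarily_equivalent T1 T2 <->
  coincide (defect_space w T1) (char_fun w T1 B1 D1)
           (defect_space w T2) (char_fun w T2 B2 D2).
Proof.
split.
- exact: (unitarily_equivalent_coincide hw hT1 pT1 hT2 pT2 h1 h2).
- exact: (coincide_unitarily_equivalent hw hT1 pT1 hT2 pT2 h1 h2).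
Qed.
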